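(* Let $\mathbf{k}$ be a field, and let $c(3)$ denote the maximum of $\dim L_f$ over all $n$ and all homogeneous cubic polynomials $f\in\mathbf{k}[x_1,\ldots,x_n]$ of slice rank $\operatorname{rk}(f)=3$. Then $$10\le c(3)\le 12.$$
   Context: Let $\mathbf{k}$ be an arbitrary field. A subspace of linear forms is a $\mathbf{k}$-linear subspace of the space of homogeneous degree $1$ polynomials in $\mathbf{k}[x_1,\ldots,x_n]$; for such a subspace $P$, $(P)$ denotes the ideal it generates. For a homogeneous cubic polynomial $f$, the slice rank $\operatorname{rk}(f)$ is the minimal number $r$ such that $f$ belongs to the ideal $(\ell_1,\ldots,\ell_r)$ generated by $r$ linear forms. Let $\mathcal{P}_f$ denote the set of all subspaces of linear forms $P$ with $\dim P=\operatorname{rk}(f)$ and $f\in (P)$, and set $L_f:=\sum_{P\in\mathcal{P}_f}P$. For each $r$, $c(r)$ is the maximum of $\dim L_f$ over all homogeneous cubics $f$ (in any number of variables $n$) with $\operatorname{rk}(f)=r$. *)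

(* Defs.v *)
From Stdlib Require Import ClassicalEpsilon.
From mathcomp Require Import all_boot all_algebra.
From mathcomp Require Import mpoly.

Set Implicit Arguments.
Unset Strict Implicit.
Unset Printing Implicit Defensive.

Import GRing.Theory.
Local Open Scope ring_scope.

(* Forms in n.+1 variables: [dhomog m R d] is a [vectType] only for m = n.+1.
   Nothing is lost, since over zero variables the only cubic form is 0, for
   which the slice rank and the dimension of L_f are both 0. *)
Notation linform k n := (dhomog n.+1 k 1).
Notation cubic k n := (dhomog n.+1 k 3).

Definition in_ideal_gen (R : comNzRingType) (S : R -> Prop) (x : R) : Prop :=
  exists (m : nat) (a s : 'I_m -> R),
    (forall i, S (s i)) /\ x = \sum_(i < m) a i * s i.

Definition in_ideal_of_forms (k : fieldType) (n r : nat)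
    (l : r.-tuple (linform k n)) (p : {mpoly k[n.+1]}) : Prop :=
  in_ideal_gen (fun q => exists i, q = val (tnth l i)) p.

Definition in_ideal_of_space (k : fieldType) (n : nat)
    (P : {vspace linform k n}) (p : {mpoly k[n.+1]}) : Prop :=
  in_ideal_gen (fun q => exists2 u : linform k n, u \in P & q = val u) p.

Section SliceRank.
Variables (k : fieldType) (n : nat) (f : cubic k n).

Definition slice_le (r : nat) : Prop :=
  exists l : r.-tuple (linform k n), in_ideal_of_forms l (val f).

Definition slice_leb (r : nat) : bool :=
  if excluded_middle_informative (slice_le r) then true else false.

Lemma slice_lebP r : reflect (slice_le r) (slice_leb r).
Proof.
by rewrite /slice_leb; case: excluded_middle_informative => h; constructor.
Qed.

Lemma slice_leb_ex : exists r, slice_leb r.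
Proof.
have hX (i : 'I_n.+1) : ('X_i : {mpoly k[n.+1]}) \is 1.-homog.
  by rewrite dhomogX /= mdeg1.
exists n.+1; apply/slice_lebP; exists [tuple DHomog (hX i) | i < n.+1].
pose J := in_ideal_of_forms [tuple DHomog (hX i) | i < n.+1].
have J0 : J 0.
  exists 0, (fun _ => 0), (fun _ => 0); split; first by case.
  by rewrite big_ord0.
have JD p q : J p -> J q -> J (p + q).
  move=> [m [a [s [hs ->]]]] [m' [a' [s' [hs' ->]]]].
  exists (m + m')%N.
  exists (fun i => match split i with inl j => a j | inr j => a' j end).
  exists (fun i => match split i with inl j => s j | inr j => s' j end).
  split; first by move=> i; case: (split i).
  rewrite big_split_ord /=; congr (_ + _); apply: eq_bigr => i _.
    by rewrite -[lshift _ _]/(unsplit (inl i)) unsplitK.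
  by rewrite -[rshift _ _]/(unsplit (inr i)) unsplitK.
suff : J (val f) by [].
rewrite [val f]mpolyE big_seq; apply: big_ind => // m hm.
have /dhomogP /(_ m hm) /= dm := valP f.
have [i hi] : exists i, (0 < m i)%N.
  apply/existsP; apply: contra_eqT dm; rewrite negb_exists => /forallP h.
  by rewrite mdegE big1 // => i _; apply/eqP; rewrite -leqn0 leqNgt h.
exists 1%N, (fun _ => (val f)@_m *: 'X_[m - U_(i)]), (fun _ => 'X_i).
split; first by move=> _; exists i; rewrite tnth_mktuple.
rewrite big_ord1 -scalerAl -mpolyXD submK //.
by apply/mnm_lepP => j; rewrite mnm1E; case: eqP => // <-.
Qed.

Definition slice_rank : nat := ex_minn slice_leb_ex.

Lemma slice_rankP :
  slice_le slice_rank /\ (forall r, slice_le r -> (slice_rank <= r)%N).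
Proof.
rewrite /slice_rank; case: ex_minnP => r /slice_lebP hr minr.
by split=> // q /slice_lebP /minr.
Qed.

End SliceRank.

Section SubspaceSum.
Variables (k : fieldType) (V : vectType k) (Q : {vspace V} -> Prop).
Local Open Scope vspace_scope.

Definition in_subspace_sum (v : V) : Prop :=
  exists s : seq {vspace V},
    (forall P, P \in s -> Q P) /\ v \in \sum_(P <- s) P.

Lemma subspace_sum_ex :
  exists L : {vspace V}, forall v, v \in L <-> in_subspace_sum v.
Proof.
pose D d := exists s : seq {vspace V},
  (forall P, P \in s -> Q P) /\ \dim (\sum_(P <- s) P) = d.
pose Db d : bool := if excluded_middle_informative (D d) then true else false.
have DbP d : reflect (D d) (Db d).
  by rewrite /Db; case: excluded_middle_informative => h; constructor.
have ex : exists d, Db d by exists (\dim (\sum_(P <- [::]) P : {vspace V}));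
  apply/DbP; exists [::].
have bd d : Db d -> (d <= \dim {:V})%N.
  by move/DbP=> [s [_ <-]]; exact/dimvS/subvf.
case: (ex_maxnP ex bd) => d /DbP [s [hs ds]] maxd.
exists (\sum_(P <- s) P) => v; split=> [hv|[s' [hs' hv]]]; first by exists s.
have hcat P : P \in s ++ s' -> Q P by rewrite mem_cat => /orP[/hs|/hs'].
have sub : (\sum_(P <- s) P <= \sum_(P <- s ++ s') P)%VS.
  by rewrite big_cat addvSl.
have /eqP -> : (\sum_(P <- s) P == \sum_(P <- s ++ s') P)%VS.
  by rewrite eqEdim sub ds maxd //; apply/DbP; exists (s ++ s').
rewrite big_cat /=; exact: (subvP (addvSr _ _)).
Qed.

Definition subspace_sum : {vspace V} :=
  proj1_sig (constructive_indefinite_description _ subspace_sum_ex).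

Lemma mem_subspace_sum v : v \in subspace_sum <-> in_subspace_sum v.
Proof.
exact: (proj2_sig (constructive_indefinite_description _ subspace_sum_ex)).
Qed.

End SubspaceSum.

Definition min_space (k : fieldType) (n : nat) (f : cubic k n)
    (P : {vspace linform k n}) : Prop :=
  \dim P = slice_rank f /\ in_ideal_of_space P (val f).

Definition Lspace (k : fieldType) (n : nat) (f : cubic k n) :
    {vspace linform k n} :=
  subspace_sum (min_space f).

(* "c(r) = c": a relation, as it is not clear a priori that the maximum exists. *)
Definition is_c (k : fieldType) (r c : nat) : Prop :=
  (exists (n : nat) (f : cubic k n), slice_rank f = r /\ \dim (Lspace f) = c)
  /\ (forall (n : nat) (f : cubic k n),
        slice_rank f = r -> (\dim (Lspace f) <= c)%N).

(* Main.v *)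
From HB Require Import structures.
Require Import Defs.
From mathcomp Require Import all_boot all_algebra.
From mathcomp Require Import mpoly.
From mathcomp Require Import zify.
From Stdlib Require Import Classical.

(** The two bounds have separate proofs.

    Lower bound.  Give each edge ij of the complete graph on r + 1 vertices a
    variable z_ij of its own, and take the cubic sum of the x_i x_j z_ij.  The
    variables of a vertex cover generate an ideal containing this cubic, and
    so do z_ij together with a vertex cover of the graph without the edge ij.
    The complete graph has covers with r vertices, and covers with r - 1
    vertices once an edge is removed, so every variable lies in a minimal space
    as soon as the slice rank is known to be r ([graph_cubic_rank_ge]).  For
    r = 3 there are 4 + 6 = 10 variables.

    Upper bound.  Among all pairs of minimal spaces of a cubic f of slice
    rank 3 choose P and P' such that d, the dimension of W = P :&: P', is
    smallest.  As f lies in both ideals, it is congruent modulo (W) to a sum g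
    of terms e_i e'_j a_ij, where the e_i and the e'_j span complements of W in
    P and in P' and the a_ij are linear forms ([bilinear_decomposition]).  So
    M, the span of P, P' and the a_ij, has dimension at most
    (6 - d) + (3 - d) ^ 2, and it contains every minimal space that contains
    W: if such a space Q had a vector v outside M, a projection fixing M and
    killing v would turn Q into a smaller space whose ideal still contains f
    ([min_space_supported]).

    If d >= 2, a minimal space Q not containing W meets P and P' in subspaces
    whose sum has dimension at least d + 1, so Q lies in P + P', and M of
    dimension at most 5 contains everything.

    If d = 1, then W is a line <w>, dim M <= 9 and f = w q + g.  A minimal
    space Q outside M misses w and meets M in a plane, and modulo (Q) the
    quadric q involves only M.  Hence q = gam + l h0 + b1 h1 + b2 h2, where gam
    involves only M, l generates Q modulo M and b1, b2 lie in M.  If h0 lies in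
    M + <l>, then f involves only the forms of M + <l, h1, h2>, of
    dimension at most 12; otherwise a derivative of q shows that all minimal spaces lie in
    M + <l, h0> ([pencil_support]).

    If d = 0, then M has dimension up to 15 and three dimensions have to be
    saved.  A third minimal space Q outside D = P + P' forces linear relations
    between the nine a_ij modulo D + Q ([tensor_relation]).  Counting them, one
    such Q is enough unless D :&: Q is a plane inside P or inside P'
    ([generic_third]).  In the exceptional case Q is called thin below:
    it makes a single row or column of the a_ij vanish modulo D + Q.  Then a
    second thin space outside D + Q supplies the remaining relations
    ([thin_pair_equal], [thin_pair_distinct], [thin_pair_opposite]), and if no
    minimal space lies outside D + Q, this space of dimension 7 contains
    everything.

    Two operations on polynomials replace coordinates throughout: the
    substitution [subst phi] of an endomorphism phi of the space of linear
    forms, and the derivative [dderiv lam] along a scalar function lam on that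
    space.  If phi kills P then [subst phi] kills the ideal (P), and if lam
    vanishes on P then [dderiv lam] maps (P) to itself. *)

Set Implicit Arguments.
Unset Strict Implicit.
Unset Printing Implicit Defensive.

Import GRing.Theory.
Local Open Scope ring_scope.

(** * Subspaces, bases and scalar functions *)

Section VectorSpaces.
Variables (k : fieldType) (V : vectType k).
Implicit Types (u v w : V) (U W P Q M N B D : {vspace V}).

Lemma separating_scalar N v : v \notin N ->
  exists lam : {scalar V}, lam v = 1 /\ forall u, u \in N -> lam u = 0.
Proof.
move=> vN; pose E := [tuple of v :: vbasis N].
have fE : free E.
  by rewrite /= free_cons (span_basis (vbasisP N)) vN (basis_free (vbasisP N)).
exists (coord E ord0); split=> [|u uN].
  exact: (coord_free ord0 ord0 fE).
rewrite (coord_vbasis uN) linear_sum big1 //= => i _.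
have /= Ei0 := coord_free (lift ord0 i) ord0 fE.
by rewrite linearZ /= Ei0 mulr0.
Qed.

Lemma mem_annihilator N v :
  (forall lam : {scalar V}, (forall u, u \in N -> lam u = 0) -> lam v = 0) ->
  v \in N.
Proof.
move=> h; apply: contraT => /separating_scalar [lam [lamv lamN]].
by have := oner_neq0 k; rewrite -lamv (h _ lamN) eqxx.
Qed.

(** By the first and the third property [subst phi] is reduction modulo the ideal
    (P); by the second, the forms of U are among the chosen representatives. *)
Lemma projection_along P U : (U :&: P = 0)%VS ->
  exists phi : 'End(V), [/\ forall u, u \in P -> phi u = 0,
    forall u, u \in U -> phi u = u & forall u, u - phi u \in P].
Proof.
move=> UP0; pose phi : 'End(V) := (\1 - daddv_pi P U)%VF.
have phiE u : phi u = u - daddv_pi P U u by rewrite !lfun_simp.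
have PU0 : (P :&: U = 0)%VS by rewrite capvC.
exists phi; split=> u.
- by move=> uP; rewrite phiE daddv_pi_id // subrr.
- move=> uU; rewrite phiE.
  have := daddv_pi_add PU0 (subvP (addvSr P U) _ uU).
  by rewrite (daddv_pi_id UP0 uU) => /(canRL (addrK _)) ->; rewrite subrr subr0.
- by rewrite phiE opprB addrC subrK memv_pi.
Qed.

Lemma hyperplane_projection M v : v \notin M ->
  exists phi : 'End(V), phi v = 0 /\ forall u, u \in M -> phi u = u.
Proof.
move=> vM; have [|phi [phiv phiM _]] := projection_along (P := <[v]>) (U := M).
  apply/eqP; rewrite -subv0; apply/subvP => u /memv_capP[uM /vlineP[c cE]].
  move: uM; rewrite cE memv0; have [-> _|c0] := eqVneq c 0; first by rewrite scale0r.
  by move/(memvZ c^-1); rewrite scalerK // (negPf vM).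
by exists phi; split=> //; apply/phiv/memv_line.
Qed.

Definition subfamily_span (r : nat) (E : r.-tuple V) (X : {set 'I_r}) :=
  (\sum_(i in X) <[tnth E i]>)%VS.

Lemma dim_subfamily_span r (E : r.-tuple V) X : (\dim (subfamily_span E X) <= #|X|)%N.
Proof.
rewrite -sum1_card (leq_trans (dimv_leq_sum _ _ _)) //.
by apply: leq_sum => i _; rewrite dim_vline leq_b1.
Qed.

Lemma subfamily_span_sub r (E : r.-tuple V) (X : {set _}) U :
  (forall i, i \in X -> tnth E i \in U) -> (subfamily_span E X <= U)%VS.
Proof. by move=> XU; apply/subv_sumP => i /XU. Qed.

Lemma mem_subfamily_span r (E : r.-tuple V) (X : {set 'I_r}) i :
  i \in X -> tnth E i \in subfamily_span E X.
Proof. by move=> iX; apply: (subvP (sumv_sup _ iX (subvv _))); rewrite memv_line. Qed.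

Lemma span_tuple_sub r (E : r.-tuple V) U :
  (forall i, tnth E i \in U) -> (<<E>> <= U)%VS.
Proof. by move=> EU; apply/span_subvP => _ /tnthP[i ->]. Qed.

(** A largest X whose span is independent of Q works: a vector of E outside
    the sum of this span and Q could be added to X. *)
Lemma steinitz r (E : r.-tuple V) Q : exists X : {set 'I_r},
  (subfamily_span E X :&: Q = 0)%VS /\ (<<E>> <= subfamily_span E X + Q)%VS.
Proof.
pose good (X : {set 'I_r}) := (subfamily_span E X :&: Q == 0)%VS.
have good0 : good set0 by rewrite /good /subfamily_span big_set0 cap0v.
case: (arg_maxnP (fun X : {set 'I_r} => #|X|) good0) => X /eqP XQ maxX.
exists X; split=> //; apply: span_tuple_sub => i; apply: contraT => niX.
have iX : i \notin X.
  by apply: contra niX => iX; apply/(subvP (addvSl _ _))/mem_subfamily_span.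
suff : good (i |: X) by move=> /maxX; rewrite /= cardsU1 iX ltnn.
rewrite /good -subv0; apply/subvP => u /memv_capP[].
rewrite /subfamily_span big_setU1 //= => /memv_addP[_ /vlineP[c ->] [x xX ->]] uQ.
have c0 : c = 0.
  apply: contraNeq niX => c0; rewrite -(scalerK c0 (tnth E i)) memvZ //.
  by rewrite -(addrK x (c *: _)) addrC memv_add // rpredN.
move: uQ; rewrite c0 scale0r add0r => uQ.
by rewrite -XQ memv_cap [x \in _]xX.
Qed.

Lemma exists_basis P (d : nat) : \dim P = d -> exists e : d.-tuple V, basis_of P e.
Proof. by move <-; exists (vbasis P); apply: vbasisP. Qed.

Lemma extend_basis P B (d b : nat) : (B <= P)%VS -> \dim P = (d + b)%N -> \dim B = b ->
  exists (Y : d.-tuple V) (Z : b.-tuple V),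
    [/\ basis_of P (Y ++ Z), basis_of B Z & (<<Y>> :&: B = 0)%VS].
Proof.
move=> BP dP dB.
have szY : size (vbasis (P :\: B)) == d.
  by rewrite size_tuple -(eqn_add2l b) -{1}dB -{1}(capv_idPr BP) dimv_cap_compl dP addnC.
have szZ : size (vbasis B) == b by rewrite size_tuple dB.
exists (Tuple szY), (Tuple szZ) => /=.
split; [|exact: vbasisP|by rewrite (span_basis (vbasisP _)) capv_diff].
have PE : (P :\: B + B)%VS = P by rewrite addv_diff (addv_idPl BP).
rewrite -{1}PE; apply: cat_basis (vbasisP _) (vbasisP _).
by apply/directv_addP; exact: capv_diff.
Qed.

(** The basis depends on the plane B only, so that it can be used for several
    spaces Q with the same trace on D. *)
Lemma thin_basis D P B : (P <= D)%VS -> (B <= P)%VS -> \dim P = 3%N -> \dim B = 2%N ->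
  exists e : 3.-tuple V, basis_of P e /\ forall Q, (D :&: Q = B)%VS ->
    (forall i, i != ord0 -> tnth e i \in Q) /\ tnth e ord0 \notin Q.
Proof.
move=> PD BP dP dB; have [Y [Z [bYZ bZ YZ]]] := extend_basis (d := 1) BP dP dB.
exists [tuple of Y ++ Z]; split=> // Q DQ; split.
  case=> [[|i] hi] // _.
  have : (Y ++ Z)`_i.+1 \in B.
    apply: (basis_mem bZ); rewrite nth_cat size_tuple subn1.
    by apply: mem_nth; rewrite size_tuple.
  by rewrite (tnth_nth 0) -DQ => /memv_capP[].
have eY : (Y ++ Z)`_0 \in Y by rewrite nth_cat size_tuple; apply: mem_nth; rewrite size_tuple.
have eYZ : (Y ++ Z)`_0 \in Y ++ Z by rewrite mem_cat eY.
rewrite (tnth_nth 0); apply/negP => eQ.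
have : (Y ++ Z)`_0 \in (<<Y>> :&: B)%VS.
  by rewrite -DQ !memv_cap eQ (subvP PD) ?(basis_mem bYZ) //= memv_span.
by rewrite YZ memv0 (negPf (basis_not0 bYZ eYZ)).
Qed.

Lemma line_exchange U u v : u \in (U + <[v]>)%VS -> u \notin U -> v \in (U + <[u]>)%VS.
Proof.
move=> /memv_addP[x xU [_ /vlineP[c ->] uE]] uU.
have c0 : c != 0 by apply: contraNneq uU => c0; rewrite uE c0 scale0r addr0.
rewrite -(scalerK c0 v) memvZ // -(addKr x (c *: v)) -uE.
by rewrite memv_add ?memvN ?memv_line.
Qed.

Lemma dim_add_span U (s : seq V) : (\dim (U + <<s>>) <= \dim U + size s)%N.
Proof.
by rewrite (leq_trans (dimv_add_leqif _ _)) // leq_add2l dim_span.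
Qed.

(** The intersection of Q :&: P with Q :&: P' lies in the proper subspace
    Q :&: (P :&: P') of P :&: P', so their sum has dimension at least
    [d + d - d.-1]. *)
Lemma meet_sum_dim P P' Q (d : nat) : \dim (P :&: P') = d ->
    (d <= \dim (Q :&: P))%N -> (d <= \dim (Q :&: P'))%N -> ~~ (P :&: P' <= Q)%VS ->
  (d < \dim (Q :&: (P + P')))%N.
Proof.
move=> dW dQP dQP' WQ.
have h1 : (\dim (Q :&: P + Q :&: P') <= \dim (Q :&: (P + P')))%N.
  by apply: dimvS; rewrite subv_add !capvS ?addvSl ?addvSr.
have h2 : (\dim (Q :&: P :&: (Q :&: P')) < d)%N.
  have WQW : (\dim (Q :&: (P :&: P')) < d)%N.
    rewrite -dW (ltn_leqif (dimv_leqif_sup (capvSr _ _))) subv_cap subvv andbT.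
    exact: WQ.
  apply: leq_ltn_trans WQW; apply: dimvS; rewrite !subv_cap.
  rewrite (subv_trans (capvSl _ _) (capvSl _ _)) (subv_trans (capvSl _ _) (capvSr _ _)).
  by rewrite (subv_trans (capvSr _ _) (capvSr _ _)).
have := dimv_sum_cap (Q :&: P) (Q :&: P').
move: (\dim (Q :&: P + Q :&: P')) (\dim (Q :&: P :&: (Q :&: P'))) h1 h2 => x y h1 h2.
by move: (\dim _) (\dim _) (\dim _) dQP dQP' h1 h2; clear; lia.
Qed.

End VectorSpaces.

(** * Ideals generated by linear forms *)

Section Ideals.
Variables (k : fieldType) (n : nat).
Local Notation V := (linform k n).
Local Notation R := {mpoly k[n.+1]}.
Implicit Types (u v w : V) (P Q M N W : {vspace V}) (p q : R).
Implicit Types (phi psi : 'End(V)) (lam : {scalar V}).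

Lemma ideal_mem P u : u \in P -> in_ideal_of_space P (val u).
Proof.
move=> uP; exists 1%N, (fun _ => 1), (fun _ => val u); split; first by exists u.
by rewrite big_ord1 mul1r.
Qed.

Lemma ideal_mem0 P : in_ideal_of_space P 0.
Proof.
by exists 0%N, (fun _ => 0), (fun _ => 0); split; [case | rewrite big_ord0].
Qed.

Lemma ideal_add P p q :
  in_ideal_of_space P p -> in_ideal_of_space P q -> in_ideal_of_space P (p + q).
Proof.
move=> [m [a [s [hs ->]]]] [m' [a' [s' [hs' ->]]]].
exists (m + m')%N, (fun i => match split i with inl j => a j | inr j => a' j end),
  (fun i => match split i with inl j => s j | inr j => s' j end).
split; first by move=> i; case: (split i).
rewrite big_split_ord /=; congr (_ + _); apply: eq_bigr => i _.
  by rewrite -[lshift _ _]/(unsplit (inl i)) unsplitK.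
by rewrite -[rshift _ _]/(unsplit (inr i)) unsplitK.
Qed.

Lemma ideal_mull P p q : in_ideal_of_space P q -> in_ideal_of_space P (p * q).
Proof.
move=> [m [a [s [hs ->]]]]; exists m, (fun i => p * a i), s; split=> //.
by rewrite mulr_sumr; apply: eq_bigr => i _; rewrite mulrA.
Qed.

Lemma ideal_mulr P p q : in_ideal_of_space P p -> in_ideal_of_space P (p * q).
Proof. by rewrite mulrC; apply: ideal_mull. Qed.

Lemma ideal_sub P p q :
  in_ideal_of_space P p -> in_ideal_of_space P q -> in_ideal_of_space P (p - q).
Proof. by move=> hp hq; apply: ideal_add => //; rewrite -mulN1r; apply: ideal_mull. Qed.

Lemma ideal_sum P I (r : seq I) (C : pred I) (F : I -> R) :
  (forall i, C i -> in_ideal_of_space P (F i)) ->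
  in_ideal_of_space P (\sum_(i <- r | C i) F i).
Proof. by move=> h; apply: big_ind => //; [exact: ideal_mem0 | exact: ideal_add]. Qed.

Lemma ideal_ind P (K : R -> Prop) :
  K 0 -> (forall p q, K p -> K q -> K (p + q)) ->
  (forall a u, u \in P -> K (a * val u)) ->
  forall p, in_ideal_of_space P p -> K p.
Proof.
move=> K0 KD KM p [m [a [s [hs ->]]]]; apply: big_ind => // i _.
by have [u uP ->] := hs i; apply: KM.
Qed.

Lemma ideal_mono P Q p : (P <= Q)%VS -> in_ideal_of_space P p -> in_ideal_of_space Q p.
Proof.
move=> /subvP PQ; move: p; apply: ideal_ind => [|? ?|a u uP]; [exact: ideal_mem0|exact: ideal_add|].
by apply/ideal_mull/ideal_mem/PQ.
Qed.

Lemma ideal_zero p : in_ideal_of_space 0%VS p -> p = 0.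
Proof.
move: p; apply: ideal_ind => [//|? ? -> ->|a u]; first by rewrite addr0.
by rewrite memv0 => /eqP ->; rewrite mulr0.
Qed.

Lemma linform_homog u : val u \is 1.-homog.
Proof. exact: dhomog_is_dhomog. Qed.

Lemma homog_form p : p \is 1.-homog -> exists u : V, p = val u.
Proof. by move=> hp; exists (DHomog hp). Qed.

Lemma linformE u : val u = \sum_i (val u)@_U_(i) *: 'X_i.
Proof.
apply/mpolyP => m; rewrite raddf_sum /=.
have [/mdeg1P[j /eqP ->]|m1] := boolP (mdeg m == 1%N).
  rewrite (bigD1 j) //= big1 => [|i ij]; rewrite mcoeffZ mcoeffXU.
    by rewrite eqxx mulr1 addr0.
  by rewrite (negPf ij) mulr0.
rewrite (dhomog_nemf_coeff (linform_homog u)) // big1 // => i _.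
rewrite mcoeffZ mcoeffX; case: eqP => [mE|]; last by rewrite mulr0.
by rewrite -mE mdeg1 eqxx in m1.
Qed.

Fact varform_subproof (i : 'I_n.+1) : ('X_i : R) \is 1.-homog.
Proof. by rewrite dhomogX /= mdeg1. Qed.

Definition varform i : V := DHomog (varform_subproof i).

Lemma linform_sum u : u = \sum_i (val u)@_U_(i) *: varform i.
Proof.
by apply: val_inj; rewrite {1}linformE raddf_sum; apply: eq_bigr => i _.
Qed.

Lemma dim_linforms : \dim {: V} = n.+1.
Proof.
pose X : n.+1.-tuple V := [tuple varform i | i < n.+1].
suff /vector.size_basis : basis_of {: V} X by [].
rewrite /basis_of eqEsubv subvf; apply/andP; split.
  apply/subvP => u _; rewrite (linform_sum u); apply: memv_suml => i _.
  by apply/memvZ/memv_span/mapP; exists i; rewrite ?mem_enum.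
apply/freeP => c c0 i.
have := congr1 (fun u : V => (val u)@_U_(i)) c0.
rewrite /= mcoeff0 !raddf_sum /= (bigD1 i) //= big1 => [|j ji].
  by rewrite nth_mktuple mcoeffZ mcoeffXU eqxx mulr1 addr0.
by rewrite nth_mktuple mcoeffZ mcoeffXU (negPf ji) mulr0.
Qed.

(** Used to prove identities about [subst] and [dderiv] by checking them on
    constants and variables. *)
Lemma mpoly_alg_ind (K : R -> Prop) :
  (forall c, K c%:MP) -> (forall i, K 'X_i) ->
  (forall p q, K p -> K q -> K (p + q)) -> (forall p q, K p -> K q -> K (p * q)) ->
  forall p, K p.
Proof.
move=> KC KX KD KM; elim/mpolyind=> [|c m p _ _ Kp]; first by rewrite -mpolyC0.
apply: (KD) => //; rewrite -mul_mpolyC; apply: (KM) => //.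
rewrite mpolyXE_id; apply: (big_ind K) => [|p1 p2|i _].
- by rewrite -mpolyC1.
- exact: (KM).
elim: (m i) => [|j IHj]; first by rewrite expr0 -mpolyC1.
by rewrite exprS; apply: (KM).
Qed.

(** The k-algebra endomorphism of the polynomial ring extending phi. *)
Definition subst phi : R -> R :=
  comp_mpoly [tuple val (phi (varform i)) | i < n.+1].

HB.instance Definition _ phi := GRing.LRMorphism.on (subst phi).

Lemma subst_form phi u : subst phi (val u) = val (phi u).
Proof.
rewrite {1}linformE {2}(linform_sum u) !linear_sum; apply: eq_bigr => i _.
rewrite !linearZ /=; congr (_ *: _).
by rewrite /subst comp_mpolyXU -tnth_nth tnth_mktuple.
Qed.

Lemma subst_comp phi psi p : subst phi (subst psi p) = subst (phi \o psi)%VF p.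
Proof.
elim/mpoly_alg_ind: p => [c|i|p q Kp Kq|p q Kp Kq].
- by rewrite /subst !comp_mpolyC.
- by rewrite -['X_i]/(val (varform i)) !subst_form comp_lfunE.
- by rewrite !raddfD /= Kp Kq.
- by rewrite !rmorphM /= Kp Kq.
Qed.

Lemma subst_homog phi d p : p \is d.-homog -> subst phi p \is d.-homog.
Proof.
move=> /dhomogP hp; rewrite /subst comp_mpolyE big_seq; apply: rpred_sum => m mp.
have <- : mdeg m = d := hp m mp.
apply: rpredZ; rewrite mdegE; elim/big_rec2: _ => [|i q e _ h].
  exact: dhomog1.
apply: dhomogM h; rewrite tnth_mktuple.
by have := dhomogMn (m i) (linform_homog (phi (varform i))); rewrite mul1n.
Qed.

Lemma subst_kill P phi p : (forall u, u \in P -> phi u = 0) ->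
  in_ideal_of_space P p -> subst phi p = 0.
Proof.
move=> phiP; move: p; apply: ideal_ind => [|a b|a u uP]; first exact: raddf0.
  by rewrite raddfD /= => -> ->; rewrite addr0.
by rewrite rmorphM /= subst_form phiP // mulr0.
Qed.

Lemma subst_ideal P phi p :
  in_ideal_of_space P p -> in_ideal_of_space (phi @: P)%VS (subst phi p).
Proof.
move: p; apply: ideal_ind => [|a b ha hb|a u uP]; first by rewrite raddf0; apply: ideal_mem0.
  by rewrite raddfD; apply: ideal_add.
by rewrite rmorphM /= subst_form; apply/ideal_mull/ideal_mem/memv_img.
Qed.

(** Holds for the variables by hypothesis, and
    [p q - p' q' = (p - p') q + p' (q - q')]. *)
Lemma subst_diff P phi p : (forall u, u - phi u \in P) ->
  in_ideal_of_space P (p - subst phi p).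
Proof.
move=> phiP; elim/mpoly_alg_ind: p => [c|i|p q Kp Kq|p q Kp Kq].
- by rewrite /subst comp_mpolyC subrr; apply: ideal_mem0.
- rewrite -['X_i]/(val (varform i)) subst_form -GRing.valB.
  exact: ideal_mem.
- by rewrite raddfD opprD addrACA; apply: ideal_add.
- rewrite rmorphM /= -(subrK (subst phi p * q) (p * q)) -addrA -mulrBl -mulrBr.
  by apply: ideal_add; [exact: ideal_mulr | exact: ideal_mull].
Qed.

Lemma ideal_linform P u : in_ideal_of_space P (val u) -> u \in P.
Proof.
have [|phi [phiP _ phid]] := projection_along (P := P) (U := 0%VS).
  exact: cap0v.
move/(subst_kill phiP); rewrite subst_form => phi0.
have {}phi0 : phi u = 0 by apply: val_inj.
by rewrite -[u]subr0 -phi0.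
Qed.

(** The derivation along the vector lam of the dual space; on linear forms it is
    evaluation by lam ([dderiv_form]). *)
Definition dderiv lam p : R := \sum_i lam (varform i) *: p^`M(i).

Fact dderiv_is_linear lam : linear (dderiv lam).
Proof.
move=> c p q; rewrite /dderiv scaler_sumr -big_split /=; apply: eq_bigr => i _.
by rewrite linearP scalerDr !scalerA mulrC.
Qed.

HB.instance Definition _ lam := GRing.isLinear.Build k R R _ (dderiv lam)
  (dderiv_is_linear lam).

Lemma dderivM lam p q : dderiv lam (p * q) = dderiv lam p * q + p * dderiv lam q.
Proof.
rewrite /dderiv mulr_suml mulr_sumr -big_split /=; apply: eq_bigr => i _.
by rewrite mderivM scalerDr scalerAl scalerAr.
Qed.

Lemma dderivC lam c : dderiv lam c%:MP = 0.
Proof. by rewrite /dderiv big1 // => i _; rewrite mderivC scaler0. Qed.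

Lemma dderiv_form lam u : dderiv lam (val u) = (lam u)%:MP.
Proof.
have lamu : lam u = \sum_i (val u)@_U_(i) * lam (varform i).
  by rewrite {1}(linform_sum u) linear_sum; apply: eq_bigr => i _; rewrite linearZ.
rewrite {1}linformE lamu !raddf_sum /=; apply: eq_bigr => i _.
rewrite linearZ /= mpolyCM mul_mpolyC; congr (_ *: _).
rewrite /dderiv (bigD1 i) //= big1 => [|j ji]; rewrite mderivX mnm1E.
  by rewrite eqxx scale1r addr0 -{1}[U_(i)%MM]add0m addmK mpolyX0 alg_mpolyC.
by rewrite eq_sym (negPf ji) scale0r scaler0.
Qed.

Lemma dderiv_ideal P lam p : (forall u, u \in P -> lam u = 0) ->
  in_ideal_of_space P p -> in_ideal_of_space P (dderiv lam p).
Proof.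
move=> lamP; move: p; apply: ideal_ind => [|a b ha hb|a u uP].
- by rewrite raddf0; apply: ideal_mem0.
- by rewrite raddfD; apply: ideal_add.
- rewrite dderivM dderiv_form lamP // mulr0 addr0; exact/ideal_mull/ideal_mem.
Qed.

(** A coordinate-free way to say that p is a polynomial in the forms of M.
    Quantifying over all phi, instead of fixing a projection onto M, makes
    sums, products and enlargements of M immediate. *)
Definition supported M p :=
  forall phi, (forall u, u \in M -> phi u = u) -> subst phi p = p.

Lemma supported_form M u : u \in M -> supported M (val u).
Proof. by move=> uM phi phiM; rewrite subst_form phiM. Qed.

Lemma supportedD M p q : supported M p -> supported M q -> supported M (p + q).
Proof. by move=> hp hq phi h; rewrite raddfD /= hp ?hq. Qed.

Lemma supportedM M p q : supported M p -> supported M q -> supported M (p * q).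
Proof. by move=> hp hq phi h; rewrite rmorphM /= hp ?hq. Qed.

Lemma supported_sum M I (r : seq I) (C : pred I) (F : I -> R) :
  (forall i, C i -> supported M (F i)) -> supported M (\sum_(i <- r | C i) F i).
Proof.
move=> h; apply: (big_ind (supported M)) => //; last exact: supportedD.
by move=> phi _; rewrite raddf0.
Qed.

Lemma supportedS M N p : (M <= N)%VS -> supported M p -> supported N p.
Proof. by move=> /subvP MN h phi phiN; apply: h => u /MN; apply: phiN. Qed.

Lemma supported_subst M phi p : (phi @: M <= M)%VS -> supported M p ->
  supported M (subst phi p).
Proof.
move=> /subvP phiM pM psi psiM.
have pE : subst (projv M) p = p by apply: pM; apply: projv_id.
rewrite -pE !subst_comp; congr (subst _ p); apply/lfunP => u.
rewrite !comp_lfunE psiM //; apply/phiM/memv_img/memv_proj.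
Qed.

Lemma dderiv_supported M lam p : (forall u, u \in M -> lam u = 0) ->
  supported M p -> dderiv lam p = 0.
Proof.
move=> lamM sp; rewrite -(sp (projv M)); last exact: projv_id.
elim/mpoly_alg_ind: p {sp} => [c|i|p q Kp Kq|p q Kp Kq].
- by rewrite /subst comp_mpolyC dderivC.
- rewrite -['X_i]/(val (varform i)) subst_form dderiv_form lamM ?memv_proj //.
- by rewrite !raddfD /= Kp Kq addr0.
- by rewrite rmorphM /= dderivM Kp Kq mul0r mulr0 addr0.
Qed.

Lemma pihomogM1 d u p :
  pihomog mdeg d (val u * p) = if d is e.+1 then val u * pihomog mdeg e p else 0.
Proof.
rewrite {1}(pihomog_partitionE (leqnn (mmeasure mdeg p))) mulr_sumr linear_sum /=.
have hom e : val u * pihomog mdeg e p \is e.+1.-homog.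
  by apply: dhomogM (linform_homog u) _; apply: pihomogP.
case: d => [|d]; first by rewrite big1 // => e _; rewrite (pihomog_ne0 _ (hom e)).
rewrite [in RHS](pihomog_partitionE (leqnn (mmeasure mdeg p))) linear_sum mulr_sumr.
apply: eq_bigr => e _; have [->|ed] := eqVneq (e : nat) d.
  by rewrite /= pihomog_id pihomog_dE.
by rewrite /= (pihomog_ne0 _ (hom e)) // (pihomog_ne0 ed (pihomogP _ _ _)) mulr0.
Qed.

Lemma ideal_pihomog P d p :
  in_ideal_of_space P p -> in_ideal_of_space P (pihomog mdeg d p).
Proof.
move: p; apply: ideal_ind => [|a b ha hb|a u uP].
- by rewrite raddf0; apply: ideal_mem0.
- by rewrite raddfD; apply: ideal_add.
- rewrite mulrC pihomogM1; case: d => [|d]; first exact: ideal_mem0.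
  exact/ideal_mulr/ideal_mem.
Qed.

(** Expressing the generators through W and E gives cofactors of arbitrary
    degree; keeping only their components of degree d is harmless because p is
    homogeneous. *)
Lemma ideal_decomposition W r (E : r.-tuple V) d p : p \is d.+1.-homog ->
  in_ideal_of_space (W + <<E>>)%VS p ->
  exists q : 'I_r -> R, (forall i, q i \is d.-homog) /\
    in_ideal_of_space W (p - \sum_i val (tnth E i) * q i).
Proof.
move=> hp hI.
have [q hq] : exists q : 'I_r -> R,
    in_ideal_of_space W (p - \sum_i val (tnth E i) * q i).
  move: p hI {hp}; apply: ideal_ind => [|a b [q ha] [q' hb]|a u].
  - exists (fun _ => 0); rewrite big1 ?subr0; first exact: ideal_mem0.
    by move=> i _; rewrite mulr0.
  - exists (fun i => q i + q' i).
    under eq_bigr do rewrite mulrDr.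
    by rewrite big_split /= opprD addrACA; apply: ideal_add.
  - case/memv_addP => w wW [v /coord_span -> ->].
    exists (fun i => coord E i v *: a).
    rewrite raddfD raddf_sum mulrDr mulr_sumr /= -addrA -sumrB.
    rewrite big1 ?addr0; first exact/ideal_mull/ideal_mem.
    by move=> i _; rewrite -tnth_nth -scalerAr -scalerAr mulrC subrr.
exists (fun i => pihomog mdeg d (q i)); split=> [i|]; first exact: pihomogP.
rewrite -{1}(pihomog_dE hp).
have -> : \sum_i val (tnth E i) * pihomog mdeg d (q i) =
    pihomog mdeg d.+1 (\sum_i val (tnth E i) * q i).
  by rewrite raddf_sum; apply: eq_bigr => i _; rewrite /= pihomogM1.
by rewrite -raddfB; apply: ideal_pihomog.
Qed.

End Ideals.

(** * Minimal spaces of a cubic *)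

Section MinimalSpaces.
Variables (k : fieldType) (n : nat).
Local Notation V := (linform k n).
Local Notation R := {mpoly k[n.+1]}.
Implicit Types (u v w : V) (P Q M N W : {vspace V}) (p q : R) (f : cubic k n).

(** Slice rank is defined by families of forms and minimal spaces by subspaces;
    this and [slice_rank_space] translate between the two. *)
Lemma slice_rank_le_dim f P : in_ideal_of_space P (val f) -> (slice_rank f <= \dim P)%N.
Proof.
move=> fP; apply: (proj2 (slice_rankP f)); exists (vbasis P).
have [|q [_ /ideal_zero /eqP]] := ideal_decomposition (W := 0%VS) (E := vbasis P)
    (dhomog_is_dhomog f : val f \is 3.-homog).
  by rewrite add0v (span_basis (vbasisP P)).
rewrite subr_eq0 => /eqP ->; exists (\dim P), q, (fun i => val (tnth (vbasis P) i)).
by split=> [i|]; [exists i | apply: eq_bigr => i _; rewrite mulrC].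
Qed.

Lemma slice_rank_space f : exists P, (\dim P <= slice_rank f)%N /\ in_ideal_of_space P (val f).
Proof.
have [l [m [a [s [hs ->]]]]] := proj1 (slice_rankP f).
exists <<l>>%VS; split; first by rewrite -[X in (_ <= X)%N](size_tuple l) dim_span.
apply: ideal_sum => i _; have [j ->] := hs i.
exact/ideal_mull/ideal_mem/memv_span/mem_tnth.
Qed.

Lemma Lspace_sub f N : (forall P, min_space f P -> (P <= N)%VS) -> (Lspace f <= N)%VS.
Proof.
move=> minN; apply/subvP => v /mem_subspace_sum [s [hs hv]]; apply: subvP hv.
rewrite big_seq; apply: (big_ind (fun U => (U <= N)%VS)) => [|U U' h h'|P /hs /minN //].
  exact: sub0v.
by rewrite subv_add h.
Qed.

Lemma min_space_sub_Lspace f P : min_space f P -> (P <= Lspace f)%VS.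
Proof.
move=> minP; apply/subvP => v vP; apply/mem_subspace_sum; exists [:: P].
by rewrite big_seq1; split=> // Q; rewrite inE => /eqP ->.
Qed.

(** Otherwise P has a vector v outside M.  A projection phi fixing M and killing v
    changes f only by an element of (W), and W is contained in phi @: P, so f
    lies in the ideal of phi @: P, a space of dimension less than that of P. *)
Lemma min_space_supported f W M g P :
    in_ideal_of_space W (val f - g) -> supported M g -> (W <= M)%VS -> (W <= P)%VS ->
  min_space f P -> (P <= M)%VS.
Proof.
move=> fg gM /subvP WM WP [dimP fP]; apply: contraT => /subvPn [v vP vM].
have [phi [phiv phiM]] := hyperplane_projection vM.
have WphiP : (W <= phi @: P)%VS.
  apply/subvP => w wW; rewrite -(phiM w (WM w wW)); apply: memv_img.
  exact: (subvP WP).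
have h1 : in_ideal_of_space (phi @: P)%VS (subst phi (val f - g)).
  apply: ideal_mono (subst_ideal phi fg).
  by rewrite (subv_trans _ WphiP) //; apply/subvP => _ /memv_imgP[w wW ->]; rewrite phiM ?WM.
have /slice_rank_le_dim : in_ideal_of_space (phi @: P)%VS (val f).
  have -> : val f = (val f - g) - subst phi (val f - g) + subst phi (val f).
    by rewrite raddfB /= (gM phi phiM) opprB addrA subrK subrK.
  apply: ideal_add (subst_ideal phi fP); apply: ideal_sub h1; exact: ideal_mono WphiP fg.
rewrite -dimP -(limg_ker_dim phi P) leqNgt -addn1 addnC leq_add2r lt0n dimv_eq0.
case/negP; apply: contraTneq isT => K0.
have : v \in (P :&: lker phi)%VS by rewrite memv_cap vP memv_ker phiv eqxx.
by rewrite K0 memv0 => /eqP v0; rewrite v0 mem0v in vM.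
Qed.

Definition covers f N := forall P, min_space f P -> (P <= N)%VS.

Definition covered_by f d := exists N, covers f N /\ (\dim N <= d)%N.

Lemma covers_or f N : covers f N \/ exists Q, min_space f Q /\ ~~ (Q <= N)%VS.
Proof.
have [[Q hQ]|noQ] := classic (exists Q, min_space f Q /\ ~~ (Q <= N)%VS).
  by right; exists Q.
by left=> Q mQ; apply: contraT => QN; case: noQ; exists Q.
Qed.

Lemma supported_covers f N : supported N (val f) -> covers f N.
Proof.
move=> fN P; apply: (@min_space_supported f 0%VS N (val f)) => //; rewrite ?sub0v //.
by rewrite subrr; apply: ideal_mem0.
Qed.

Definition trilinear_sum r r' (e : r.-tuple V) (e' : r'.-tuple V) (a : 'I_r -> 'I_r' -> V) : R :=
  \sum_i \sum_j val (tnth e i) * val (tnth e' j) * val (a i j).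

Lemma trilinear_sum_sym r r' (e : r.-tuple V) (e' : r'.-tuple V) a :
  trilinear_sum e e' a = trilinear_sum e' e (fun j i => a i j).
Proof.
rewrite /trilinear_sum exchange_big; apply: eq_bigr => j _; apply: eq_bigr => i _.
by rewrite [val (tnth e i) * _]mulrC.
Qed.

Lemma trilinear_sum_homog r r' (e : r.-tuple V) (e' : r'.-tuple V) a : trilinear_sum e e' a \is 3.-homog.
Proof.
apply: rpred_sum => i _; apply: rpred_sum => j _.
exact: dhomogM (dhomogM (linform_homog _) (linform_homog _)) (linform_homog _).
Qed.

Lemma trilinear_sum_supported r r' (e : r.-tuple V) (e' : r'.-tuple V) a N :
  (forall i, tnth e i \in N) -> (forall j, tnth e' j \in N) ->
  (forall i j, a i j \in N) -> supported N (trilinear_sum e e' a).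
Proof.
move=> eN e'N aN; apply: supported_sum => i _; apply: supported_sum => j _.
by apply: supportedM; [apply: supportedM|]; apply: supported_form.
Qed.

(** Write p as a sum of E_i q_i modulo (W), and reduce modulo the ideal of
    W + <<E'>> by a projection phi that fixes <<E>>: since p vanishes, so does
    the sum of the E_i (subst phi q_i).  Hence q_i may be replaced by
    q_i - subst phi q_i, which lies in the ideal of W + <<E'>>. *)
Lemma bilinear_decomposition W r r' (E : r.-tuple V) (E' : r'.-tuple V) p :
    p \is 3.-homog -> (<<E>> :&: (W + <<E'>>) = 0)%VS ->
    in_ideal_of_space (W + <<E>>)%VS p -> in_ideal_of_space (W + <<E'>>)%VS p ->
  exists a : 'I_r -> 'I_r' -> V, in_ideal_of_space W
    (p - \sum_i \sum_j val (tnth E i) * val (tnth E' j) * val (a i j)).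
Proof.
move=> hp EE' pE pE'.
have [q [hq pq]] := ideal_decomposition hp pE.
have [phi [phiE' phiE phid]] := projection_along EE'.
have /fin_all_exists [b hb] : forall i, exists b : 'I_r' -> V, in_ideal_of_space W
    (q i - subst phi (q i) - \sum_j val (tnth E' j) * val (b j)).
  move=> i; have [||b [hb1 hb2]] := @ideal_decomposition _ _ W _ E' 1 (q i - subst phi (q i)).
  - by rewrite rpredB //; apply: subst_homog.
  - exact: subst_diff.
  - have /fin_all_exists [b' b'E] j := homog_form (hb1 j).
    by exists b'; under eq_bigr => j _ do rewrite -b'E.
exists b.
have E0 : \sum_i val (tnth E i) * subst phi (q i) = 0.
  have := subst_kill phiE' (ideal_mono (addvSl _ _) pq).
  rewrite raddfB /= (subst_kill phiE' pE') sub0r => /eqP; rewrite oppr_eq0 raddf_sum => /eqP h.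
  rewrite -[RHS]h /=; apply: eq_bigr => i _; rewrite rmorphM /= subst_form phiE //.
  exact/memv_span/mem_tnth.
have -> : p - \sum_i \sum_j val (tnth E i) * val (tnth E' j) * val (b i j) =
    (p - \sum_i val (tnth E i) * q i) + \sum_i val (tnth E i) *
     (q i - subst phi (q i) - \sum_j val (tnth E' j) * val (b i j)).
  under [X in _ = _ + X]eq_bigr do rewrite !mulrBr.
  rewrite !sumrB E0 subr0 addrA subrK; congr (_ - _).
  by apply: eq_bigr => i _; rewrite mulr_sumr; apply: eq_bigr => j _; rewrite mulrA.
by apply: ideal_add => //; apply: ideal_sum => i _; apply: ideal_mull.
Qed.

End MinimalSpaces.

(** * Relations imposed by a further space *)

Section ProductRelations.
Variables (k : fieldType) (n : nat).
Local Notation V := (linform k n).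
Local Notation R := {mpoly k[n.+1]}.
Variables (r : nat) (E : r.-tuple V) (T : finType) (p1 p2 : T -> 'I_r).
Hypothesis p12 : forall s, (p1 s < p2 s)%N.
Hypothesis p_inj : injective (fun s => (p1 s, p2 s)).

(** The second derivative in the directions dual to E_(p1 s) and E_(p2 s) maps
    the product indexed by t to 1 if t = s and to 0 otherwise; the ordering
    p1 < p2 excludes the pair with exchanged entries. *)
Lemma products_free (c : T -> k) : free E ->
  \sum_s c s *: (val (tnth E (p1 s)) * val (tnth E (p2 s))) = 0 -> forall s, c s = 0.
Proof.
move=> fE c0 s.
pose D i := dderiv (coord E i).
have DE i j : D i (val (tnth E j)) = ((j == i)%:R)%:MP.
  by rewrite /D dderiv_form /= (tnth_nth 0) coord_free.
have DM i p q : D i (p * q) = D i p * q + p * D i q by exact: dderivM.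
have DD i p q : D i (p + q) = D i p + D i q by exact: raddfD.
have DZ i x p : D i (x *: p) = x *: D i p by exact: linearZ.
have DS i (F : T -> R) : D i (\sum_t F t) = \sum_t D i (F t) by exact: raddf_sum.
have D0 i : D i 0 = 0 by exact: raddf0.
have DC i x : D i x%:MP = 0 by exact: dderivC.
have D2 t : D (p1 s) (D (p2 s) (val (tnth E (p1 t)) * val (tnth E (p2 t)))) = (t == s)%:R%:MP.
  rewrite DM !DE DD !DM !DE !DC !mul0r !mulr0.
  rewrite addr0 add0r -!mpolyCM -!natrM -raddfD -natrD /=; congr (_%:R%:MP).
  (* t contributes if its pair is that of s, or that of s with entries exchanged. *)
  rewrite -[t == s](inj_eq p_inj) xpair_eqE !mulnb.
  have [/eqP e1|] := boolP (p1 t == p2 s); have [/eqP e2|] := boolP (p2 t == p1 s);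
    rewrite /= ?andbF ?addn0 ?add0n //.
  have := p12 t; have := p12 s; rewrite -e1 -e2 => h1 h2.
  by have := ltn_trans h1 h2; rewrite ltnn.
have := congr1 (D (p1 s) \o D (p2 s)) c0; rewrite /= !D0 !DS.
rewrite (bigD1 s) //= big1 => [|t ts].
  rewrite addr0 !DZ D2 eqxx -mul_mpolyC -mpolyCM mulr1.
  by move/eqP; rewrite mpolyC_eq0 => /eqP.
by rewrite !DZ D2 (negPf ts) mpolyC0 scaler0.
Qed.

(** Take lam vanishing on N.  Then [dderiv lam p] is the sum of the
    lam (a s) E_(p1 s) E_(p2 s), and it lies in (Q) since lam vanishes on Q.
    Reduce modulo (Q) by a projection that fixes the E_i with i in X: the terms
    not supported by X disappear, the others are unchanged, and they are
    linearly independent.  Hence lam (a s) = 0. *)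
Lemma product_relation (a : T -> V) (p : R) (Q N : {vspace V}) (X : {set 'I_r}) :
    free E -> p = \sum_s val (tnth E (p1 s)) * val (tnth E (p2 s)) * val (a s) ->
    in_ideal_of_space Q p -> (subfamily_span E X :&: Q = 0)%VS ->
    (<<E>> <= N)%VS -> (Q <= N)%VS ->
    (forall s, ~~ ((p1 s \in X) && (p2 s \in X)) ->
       [\/ a s \in N, tnth E (p1 s) \in Q | tnth E (p2 s) \in Q]) ->
  forall s, p1 s \in X -> p2 s \in X -> a s \in N.
Proof.
move=> fE pE pQ XQ /subvP EN /subvP QN outside s s1 s2.
apply: mem_annihilator => lam lamN.
have [phi [phiQ phiX _]] := projection_along XQ.
have lamE i : lam (tnth E i) = 0 by apply/lamN/EN/memv_span/mem_tnth.
have phiE i : i \in X -> phi (tnth E i) = tnth E i.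
  by move=> iX; apply/phiX/(subvP (sumv_sup _ iX (subvv _)))/memv_line.
pose c t := if (p1 t \in X) && (p2 t \in X) then lam (a t) else 0.
suff /products_free -/(_ fE s) :
    \sum_t c t *: (val (tnth E (p1 t)) * val (tnth E (p2 t))) = 0.
  by rewrite /c s1 s2.
have := subst_kill phiQ (dderiv_ideal (fun u uQ => lamN u (QN u uQ)) pQ).
move=> h; rewrite -[RHS]h pE (raddf_sum (dderiv lam)) (raddf_sum (subst phi)).
apply: eq_bigr => t _.
rewrite /= !dderivM !dderiv_form !lamE mpolyC0 mul0r mulr0 addr0 mul0r add0r.
rewrite !rmorphM /= !subst_form /subst comp_mpolyC [_ * _%:MP_[_]]mulrC mul_mpolyC /c.
have [/andP[t1 t2]|tX] := boolP (_ && _); first by rewrite !phiE.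
have [aN|eQ|eQ] := outside t tX; first by rewrite (lamN _ aN) !scale0r.
  by rewrite (phiQ _ eQ) mul0r scaler0 scale0r.
by rewrite (phiQ _ eQ) mulr0 scaler0 scale0r.
Qed.

End ProductRelations.

(** [product_relation] for the bipartite family of products e_i e'_j. *)
Lemma tensor_relation (k : fieldType) (n r r' : nat) (e : r.-tuple (linform k n))
    (e' : r'.-tuple (linform k n)) a p Q N
    (I : {set 'I_r}) (J : {set 'I_r'}) :
    free (e ++ e') -> p = trilinear_sum e e' a -> in_ideal_of_space Q p ->
    ((subfamily_span e I + subfamily_span e' J) :&: Q = 0)%VS ->
    (<<e>> <= N)%VS -> (<<e'>> <= N)%VS -> (Q <= N)%VS ->
    (forall i j, ~~ ((i \in I) && (j \in J)) ->
      [\/ a i j \in N, tnth e i \in Q | tnth e' j \in Q]) ->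
  forall i j, i \in I -> j \in J -> a i j \in N.
Proof.
move=> fE pE pQ IJQ eN e'N QN outside i j iI jJ.
pose E := [tuple of e ++ e'].
pose p1 (s : 'I_r * 'I_r') := lshift r' s.1; pose p2 (s : 'I_r * 'I_r') := rshift r s.2.
pose X := [set lshift r' i | i in I] :|: [set rshift r j | j in J].
have lX i0 : (lshift r' i0 \in X) = (i0 \in I).
  rewrite inE (mem_imset _ _ (@lshift_inj _ _)) orbC; case: imsetP => // -[j0 _ h].
  by move/eqP: h; rewrite eq_lrshift.
have rX j0 : (rshift r j0 \in X) = (j0 \in J).
  rewrite inE (mem_imset _ _ (@rshift_inj _ _)); case: imsetP => // -[i0 _ h].
  by move/eqP: h; rewrite eq_rlshift.
apply: (@product_relation _ _ _ E _ p1 p2 _ _ (fun s => a s.1 s.2) p Q N X _ _ _ _ _ _ _ (i, j));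
  rewrite ?lX ?rX //.
- by move=> s /=; rewrite (leq_trans (ltn_ord s.1)) // leq_addr.
- move=> [i1 j1] [i2 j2] h; move: (congr1 fst h) (congr1 snd h) => e1 e2.
  by congr (_, _); [exact: lshift_inj e1 | exact: rshift_inj e2].
- rewrite pE /trilinear_sum pair_big; apply: eq_bigr => -[i0 j0] _ /=.
  by rewrite tnth_lshift tnth_rshift.
- apply/eqP; rewrite -subv0 -IJQ capvS // subfamily_span_sub // => h; rewrite inE.
  case/orP => /imsetP[x xX ->].
    by rewrite tnth_lshift (subvP (addvSl _ _)) // mem_subfamily_span.
  by rewrite tnth_rshift (subvP (addvSr _ _)) // mem_subfamily_span.
- by rewrite span_cat subv_add eN.
- move=> [i0 j0]; rewrite /p1 /p2 /= lX rX tnth_lshift tnth_rshift; exact: outside.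
Qed.

(** * Two disjoint minimal spaces *)

Section RankThree.
Variables (k : fieldType) (n : nat) (f : cubic k n).
Hypothesis rk3 : slice_rank f = 3%N.
Local Notation V := (linform k n).
Local Notation R := {mpoly k[n.+1]}.
Implicit Types (u v w : V) (P Q M N W : {vspace V}) (p q : R).

Lemma min_dim P : min_space f P -> \dim P = 3%N.
Proof. by case; rewrite rk3. Qed.

Definition disjoint_pair P P' :=
  [/\ min_space f P, min_space f P' & (P :&: P' = 0)%VS].

Lemma disjoint_pair_sym P P' : disjoint_pair P P' -> disjoint_pair P' P.
Proof. by case=> ? ? ?; split; rewrite // capvC. Qed.

Lemma disjoint_pair_dim P P' : disjoint_pair P P' -> \dim (P + P') = 6%N.
Proof.
by move=> [mP mP' PP']; rewrite dimv_disjoint_sum // !min_dim.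
Qed.

Lemma third_space_dim P P' Q : disjoint_pair P P' -> min_space f Q ->
  (\dim (P + P' + Q) + \dim ((P + P') :&: Q) = 9)%N.
Proof.
by move=> dPP mQ; rewrite dimv_sum_cap (disjoint_pair_dim dPP) (min_dim mQ).
Qed.

Lemma disjoint_pair_free P P' r r' (e : r.-tuple V) (e' : r'.-tuple V) :
  disjoint_pair P P' -> basis_of P e -> basis_of P' e' -> free (e ++ e').
Proof.
move=> [_ _ PP'] be be'; rewrite cat_free (basis_free be) (basis_free be').
rewrite (span_basis be) (span_basis be'); exact/directv_addP.
Qed.

Lemma disjoint_pair_tensor P P' r r' (e : r.-tuple V) (e' : r'.-tuple V) :
  disjoint_pair P P' -> basis_of P e -> basis_of P' e' ->
  exists a, val f = trilinear_sum e e' a.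
Proof.
move=> [[_ fP] [_ fP'] PP'] be be'.
have [||||a] := @bilinear_decomposition _ _ 0%VS _ _ e e' (val f).
- exact: dhomog_is_dhomog.
- by rewrite add0v (span_basis be) (span_basis be').
- by rewrite add0v (span_basis be).
- by rewrite add0v (span_basis be').
- by move=> /ideal_zero /eqP; rewrite subr_eq0 => /eqP fE; exists a.
Qed.

Lemma tensor_covers P P' r r' (e : r.-tuple V) (e' : r'.-tuple V) a N :
  basis_of P e -> basis_of P' e' -> val f = trilinear_sum e e' a ->
  (P <= N)%VS -> (P' <= N)%VS -> (forall i j, a i j \in N) -> covers f N.
Proof.
move=> be be' fE /subvP PN /subvP P'N aN; apply: supported_covers; rewrite fE.
apply: trilinear_sum_supported => // i.
  by apply/PN/(basis_mem be)/mem_tnth.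
by apply/P'N/(basis_mem be')/mem_tnth.
Qed.

(** With I given, choose by exchange a subset J of the basis e' such that the e_i
    (i in I), the e'_j (j in J) and Q span P + P' + Q.  Modulo P + P' + Q the
    a_ij with (i, j) in I x J are then combinations of the others, whence the
    count 9 - #|I| #|J| for the additional forms. *)
Lemma tensor_bound P P' Q (e e' : 3.-tuple V) (I : {set 'I_3}) :
    disjoint_pair P P' -> basis_of P e -> basis_of P' e' -> min_space f Q ->
    (subfamily_span e I :&: Q = 0)%VS -> (P <= subfamily_span e I + Q + P')%VS ->
  exists N (j : nat), [/\ covers f N, (j <= 3)%N,
    (6 <= #|I| + j + \dim ((P + P') :&: Q))%N &
    (\dim N + #|I| * j + \dim ((P + P') :&: Q) <= 18)%N].
Proof.
move=> dPP be be' mQ IQ Pcov; have [mP mP' PP'] := dPP; have [_ fQ] := mQ.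
have [a fE] := disjoint_pair_tensor dPP be be'.
(* Exchange relative to subfamily_span e I + Q, so that I and J stay independent jointly. *)
have [J [JQ covJ]] := steinitz e' (subfamily_span e I + Q)%VS.
pose out := enum (~: setX I J).
pose N := (P + P' + Q + <<[seq a s.1 s.2 | s <- out]>>)%VS.
have DN : (P + P' + Q <= N)%VS := addvSl _ _.
have PN : (P <= N)%VS by rewrite (subv_trans _ DN) // -addvA addvSl.
have P'N : (P' <= N)%VS by rewrite (subv_trans _ DN) // (subv_trans (addvSr P P')) // addvSl.
have QN : (Q <= N)%VS by rewrite (subv_trans _ DN) // addvSr.
have outN i j : ~~ ((i \in I) && (j \in J)) -> a i j \in N.
  move=> ij; apply: (subvP (addvSr _ _)); apply: memv_span.
  by apply/mapP; exists (i, j); rewrite // mem_enum !inE.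
have IJQ : ((subfamily_span e I + subfamily_span e' J) :&: Q = 0)%VS.
  apply/eqP; rewrite -subv0; apply/subvP => w /memv_capP[/memv_addP[u uI [v vJ wE]] wQ].
  have v0 : v = 0.
    apply/eqP; rewrite -memv0 -JQ memv_cap vJ.
    by rewrite -(addKr u v) -wE memv_add // rpredN.
  by rewrite -IQ memv_cap wQ andbT wE v0 addr0.
have allN i j : a i j \in N.
  have [/andP[iI jJ]|/outN //] := boolP ((i \in I) && (j \in J)).
  apply: (tensor_relation (disjoint_pair_free dPP be be') fE fQ IJQ) => //.
  - by rewrite (span_basis be).
  - by rewrite (span_basis be').
  - by move=> i' j' /outN h; constructor 1.
exists N, #|J|; rewrite -[X in (_ <= X)%N](card_ord 3) max_card; split=> //.
- exact: tensor_covers be be' fE PN P'N allN.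
- pose K := (subfamily_span e I + subfamily_span e' J + Q)%VS.
  have eK : (subfamily_span e I + Q <= K)%VS by rewrite /K addvS // addvSl.
  have P'K : (P' <= K)%VS.
    rewrite -(span_basis be') (subv_trans covJ) // subv_add eK andbT.
    exact: subv_trans (addvSr _ _) (addvSl _ _).
  have PK : (P + P' + Q <= K)%VS.
    have PK : (P <= K)%VS by apply: subv_trans Pcov _; rewrite subv_add eK.
    by rewrite !subv_add PK P'K addvSr.
  have dK : (\dim K <= #|I| + #|J| + 3)%N.
    rewrite (leq_trans (dimv_add_leqif _ _)) // (min_dim mQ) leq_add2r.
    rewrite (leq_trans (dimv_add_leqif _ _)) // leq_add //; exact: dim_subfamily_span.
  have := leq_trans (dimvS PK) dK; have := third_space_dim dPP mQ.
  move: (\dim (_ + Q)) (\dim (_ :&: Q)) #|I| #|J|; clear; lia.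
- have := dim_add_span (P + P' + Q) [seq a s.1 s.2 | s <- out].
  rewrite -/N size_map -cardE; have := cardsC (setX I J).
  rewrite cardsX card_prod card_ord; have := third_space_dim dPP mQ.
  move: (\dim (_ + Q)) (\dim (_ :&: Q)) (\dim N) #|~: _| (#|I| * _)%N; clear; lia.
Qed.

(** Let B = (P + P') :&: Q.  If dim B <= 1, any I obtained by exchange has
    enough elements.  If B is a plane, then I and J should have two elements
    each.  For this, split off from P the P-component x of a suitable vector b
    of B: complements of x in P remain independent of Q, and x itself is
    recovered from b modulo P'. *)
Lemma generic_third P P' Q : disjoint_pair P P' -> min_space f Q ->
    [\/ (\dim ((P + P') :&: Q) <= 1)%N |
      [/\ \dim ((P + P') :&: Q) = 2%N, ~~ ((P + P') :&: Q <= P)%VS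
        & ~~ ((P + P') :&: Q <= P')%VS]] ->
  covered_by f 12.
Proof.
move=> dPP mQ; have [mP mP' PP'] := dPP.
pose B := ((P + P') :&: Q)%VS; rewrite -/B.
have [e be] := exists_basis (min_dim mP).
have [e' be'] := exists_basis (min_dim mP').
case=> [b1|[b2 BP BP']].
  have [I [IQ covI]] := steinitz e Q.
  have [|N [j [cN j3 dj dN]]] := tensor_bound dPP be be' mQ IQ.
    by rewrite -(span_basis be) (subv_trans covI) // addvSl.
  exists N; split=> //; rewrite -/B in dj dN.
  have i3 : (#|I| <= 3)%N by rewrite -[X in (_ <= X)%N](card_ord 3) max_card.
  move: #|I| (\dim B) (\dim N) i3 j3 dj dN b1; clear; nia.
(* If B meets P, then b is chosen in P: otherwise the plane complementary to x
   in P could meet Q. *)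
have [b [bB bP' bP]] : exists b, [/\ b \in B, b \notin P'
    & (B :&: P != 0)%VS -> b \in P].
  have [BP0|BP0] := eqVneq (B :&: P)%VS 0%VS.
    by have /subvPn[b bB bP'] := BP'; exists b.
  exists (vpick (B :&: P)); have := memv_pick (B :&: P).
  case/memv_capP => pB pP; split=> //; apply: contra BP0 => pP'.
  by rewrite -vpick0 -memv0 -PP' memv_cap pP.
have /memv_addP[x xP [x' x'P' bE]] : b \in (P + P')%VS by case/memv_capP: bB.
have x0 : x != 0 by apply: contraNneq bP' => x0; rewrite bE x0 add0r.
have [|||Y [Z [bYZ bZ YZ]]] := @extend_basis _ _ P <[x]>%VS 2 1.
- by rewrite -memvE.
- exact: min_dim.
- by rewrite dim_vline x0.
have Zx : <<Z>>%VS = <[x]>%VS by exact: span_basis bZ.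
pose I := [set lshift 1 i | i in (setT : {set 'I_2})].
have IY : (subfamily_span [tuple of Y ++ Z] I <= <<Y>>)%VS.
  apply: subfamily_span_sub => _ /imsetP[i _ ->].
  by rewrite tnth_lshift; apply/memv_span/mem_tnth.
have YI : (<<Y>> <= subfamily_span [tuple of Y ++ Z] I)%VS.
  apply: span_tuple_sub => i; rewrite -(tnth_lshift Y Z).
  by apply: mem_subfamily_span; apply: imset_f.
have YP : (<<Y>> <= P)%VS by rewrite -(span_basis bYZ) span_cat addvSl.
have [||N [j [cN j3 dj dN]]] := tensor_bound dPP (e := [tuple of Y ++ Z]) (I := I) bYZ be' mQ.
- apply/eqP; rewrite -subv0; apply/subvP => v /memv_capP[/(subvP IY) vY vQ].
  have vP := subvP YP _ vY.
  have vBP : v \in (B :&: P)%VS.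
    by rewrite !memv_cap vQ vP (subvP (addvSl P P')).
  have [->|v0] := eqVneq v 0; first exact: mem0v.
  have bP0 : b \in P.
    by apply: bP; apply: contraNneq v0 => BP0; rewrite -memv0 -BP0.
  have bx : b = x.
    have x'P : x' \in (P :&: P')%VS.
      by rewrite memv_cap x'P' andbT -(addKr x x') -bE addrC memvB.
    by move: x'P; rewrite bE PP' memv0 => /eqP ->; rewrite addr0.
  have xBP : (<[x]> <= B :&: P)%VS by rewrite -memvE memv_cap xP -bx bB.
  have BPx : (B :&: P <= <[x]>)%VS.
    have : (\dim (B :&: P) < \dim B)%N.
      by rewrite (ltn_leqif (dimv_leqif_sup (capvSl B P))) subv_cap subvv BP.
    by rewrite b2 -(geq_leqif (dimv_leqif_sup xBP)) dim_vline x0.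
  by rewrite -YZ memv_cap vY (subvP BPx).
- rewrite -{1}(span_basis bYZ) span_cat subv_add Zx.
  rewrite (subv_trans YI) /=; last by rewrite -addvA addvSl.
  rewrite -memvE; have -> : x = b - x' by rewrite bE addrK.
  have /subvP QK := subv_trans (addvSr (subfamily_span [tuple of Y ++ Z] I) Q) (addvSl _ P').
  apply: memvB; last exact: (subvP (addvSr _ _)).
  by apply: QK; case/memv_capP: bB.
exists N; split=> //; rewrite -/B b2 in dj dN.
have i2 : #|I| = 2%N by rewrite card_imset ?cardsT ?card_ord //; exact: lshift_inj.
by move: (\dim N) j3 dj dN; rewrite i2; clear; nia.
Qed.

(** The a_ij outside S cost nothing when they already lie in A. *)
Lemma fill_support P P' r r' (e : r.-tuple V) (e' : r'.-tuple V) a A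
    (S : {set 'I_r * 'I_r'}) :
  basis_of P e -> basis_of P' e' -> val f = trilinear_sum e e' a -> (P + P' <= A)%VS ->
  (forall i j, (i, j) \notin S -> a i j \in A) ->
  exists N, covers f N /\ (\dim N <= \dim A + #|S|)%N.
Proof.
move=> be be' fE; rewrite subv_add => /andP[PA P'A] outS.
exists (A + <<[seq a s.1 s.2 | s <- enum S]>>)%VS; split.
  apply: (tensor_covers be be' fE); rewrite ?(subv_trans _ (addvSl _ _)) // => i j.
  have [ijS|/outS] := boolP ((i, j) \in S); last exact: (subvP (addvSl _ _)).
  apply/(subvP (addvSr _ _))/memv_span/mapP; exists (i, j) => //.
  by rewrite mem_enum.
by rewrite (leq_trans (dim_add_span _ _)) // size_map -cardE.
Qed.

(** Modulo (Q) only the terms of row i0 survive, and e_i0 and the e'_j remain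
    independent modulo Q. *)
Lemma thin_row P P' Q r r' (e : r.-tuple V) (e' : r'.-tuple V) a i0 :
    disjoint_pair P P' -> basis_of P e -> basis_of P' e' -> val f = trilinear_sum e e' a ->
    min_space f Q -> ((P + P') :&: Q <= P)%VS ->
    (forall i, i != i0 -> tnth e i \in Q) -> tnth e i0 \notin Q ->
  forall j, a i0 j \in (P + P' + Q)%VS.
Proof.
move=> dPP be be' fE mQ QP eQ e0Q j; have [mP mP' PP'] := dPP; have [_ fQ] := mQ.
apply: (tensor_relation (I := [set i0]) (J := setT) (disjoint_pair_free dPP be be') fE fQ);
  rewrite ?inE ?(span_basis be) ?(span_basis be') ?addvSr //.
- apply/eqP; rewrite -subv0; apply/subvP => w /memv_capP[].
  rewrite /subfamily_span big_set1 => /memv_addP[_ /vlineP[c ->] [v vJ wE]] wQ.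
  have vP' : v \in P'.
    by apply: (subvP _ _ vJ); apply: subfamily_span_sub => i _; apply/(basis_mem be')/mem_tnth.
  have eP : tnth e i0 \in P by apply/(basis_mem be)/mem_tnth.
  have wP : w \in P.
    by apply: (subvP QP); rewrite memv_cap wQ wE memv_add ?memvZ.
  have v0 : v = 0.
    apply/eqP; rewrite -memv0 -PP' memv_cap vP' andbT.
    by rewrite -(addKr (c *: tnth e i0) v) -wE memvD ?memvN ?memvZ.
  move: wQ; rewrite wE v0 addr0; have [->|c0] := eqVneq c 0; first by rewrite scale0r !mem0v.
  by move/(memvZ c^-1); rewrite scalerK // (negPf e0Q).
- by rewrite (subv_trans (addvSl P P')) ?addvSl.
- by rewrite (subv_trans (addvSr P P')) ?addvSl.
- move=> i' j'; rewrite !inE andbT => /eQ; by constructor 2.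
Qed.

(** P + P' + Q1 and P + P' + Q2 are distinct and contain the 6-dimensional
    P + P' as a hyperplane. *)
Lemma two_thirds_dim P P' Q1 Q2 : disjoint_pair P P' ->
    min_space f Q1 -> min_space f Q2 -> ~~ (Q2 <= P + P' + Q1)%VS ->
    \dim ((P + P') :&: Q1) = 2%N -> \dim ((P + P') :&: Q2) = 2%N ->
  ((P + P' + Q1) :&: (P + P' + Q2) <= P + P')%VS /\
  \dim ((P + P' + Q1) + (P + P' + Q2)) = 8%N.
Proof.
move=> dPP mQ1 mQ2 Q2N d1 d2.
have := third_space_dim dPP mQ1; have := third_space_dim dPP mQ2.
rewrite d1 d2; have := disjoint_pair_dim dPP.
have := dimv_sum_cap (P + P' + Q1) (P + P' + Q2).
have capD : (P + P' <= (P + P' + Q1) :&: (P + P' + Q2))%VS by rewrite subv_cap !addvSl.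
have : (\dim ((P + P' + Q1) :&: (P + P' + Q2)) < \dim (P + P' + Q2))%N.
  rewrite (ltn_leqif (dimv_leqif_sup (capvSr _ _))) subv_cap subvv andbT.
  by rewrite subv_add addvSl.
have := dimvS capD; rewrite -(geq_leqif (dimv_leqif_sup capD)).
set c := \dim (_ :&: _); set s := \dim (_ + _)%VS; move: s c.
move: (\dim (P + P')) (\dim (P + P' + Q1)) (\dim (P + P' + Q2)).
by clear; lia.
Qed.

(** The row of the a_ij complementary to the common plane lies in both
    P + P' + Q1 and P + P' + Q2, hence in P + P'; six a_ij remain, and
    6 + 6 = 12. *)
Lemma thin_pair_equal P P' Q1 Q2 : disjoint_pair P P' ->
    min_space f Q1 -> min_space f Q2 -> ~~ (Q2 <= P + P' + Q1)%VS ->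
    \dim ((P + P') :&: Q1) = 2%N -> ((P + P') :&: Q2 = (P + P') :&: Q1)%VS ->
    ((P + P') :&: Q1 <= P)%VS ->
  covered_by f 12.
Proof.
move=> dPP mQ1 mQ2 Q2N d1 eB BP; have [mP mP' PP'] := dPP.
have d2 : \dim ((P + P') :&: Q2) = 2%N by rewrite eB.
have [capD _] := two_thirds_dim dPP mQ1 mQ2 Q2N d1 d2.
have [e [be adapted]] := thin_basis (addvSl P P') BP (min_dim mP) d1.
have [e' be'] := exists_basis (min_dim mP').
have [a fE] := disjoint_pair_tensor dPP be be'.
have row Q : min_space f Q -> ((P + P') :&: Q = (P + P') :&: Q1)%VS ->
    forall j, a ord0 j \in (P + P' + Q)%VS.
  move=> mQ eQ; have [eQ1 e0] := adapted _ eQ.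
  by apply: (thin_row dPP be be' fE mQ); rewrite ?eQ.
have [|i j ij|N [cN dN]] := fill_support (A := (P + P')%VS)
    (S := setX [set~ ord0] setT) be be' fE; first by rewrite subvv.
  move: ij; rewrite !inE /= andbT negbK => /eqP ->.
  by apply: (subvP capD); rewrite memv_cap !row.
exists N; split=> //; rewrite (leq_trans dN) // (disjoint_pair_dim dPP) cardsX cardsT.
by rewrite cardsC1 !card_ord.
Qed.

(** In a basis of P adapted to both planes, Q1 and Q2 take care of two different
    rows.  The third row adds 3 to [\dim (P + P' + Q1 + Q2) = 8]. *)
Lemma thin_pair_distinct P P' Q1 Q2 : disjoint_pair P P' ->
    min_space f Q1 -> min_space f Q2 -> ~~ (Q2 <= P + P' + Q1)%VS ->
    \dim ((P + P') :&: Q1) = 2%N -> \dim ((P + P') :&: Q2) = 2%N ->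
    ((P + P') :&: Q1 != (P + P') :&: Q2)%VS ->
    ((P + P') :&: Q1 <= P)%VS -> ((P + P') :&: Q2 <= P)%VS ->
  covered_by f 12.
Proof.
move=> dPP mQ1 mQ2 Q2N d1 d2 neB BP1 BP2; have [mP mP' PP'] := dPP.
have [_ dA] := two_thirds_dim dPP mQ1 mQ2 Q2N d1 d2.
set B1 := ((P + P') :&: Q1)%VS in d1 neB BP1; set B2 := ((P + P') :&: Q2)%VS in d2 neB BP2.
have B12 : ~~ (B1 <= B2)%VS by apply: contra neB => B12; rewrite eqEdim B12 d1 d2.
have B21 : ~~ (B2 <= B1)%VS by apply: contra neB => B21; rewrite eq_sym eqEdim B21 d1 d2.
have /subvPn[v1 v1B1 v1B2] := B12; have /subvPn[v2 v2B2 v2B1] := B21.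
have B0 : (B1 :&: B2 != 0)%VS.
  have := dimv_sum_cap B1 B2; rewrite d1 d2 -dimv_eq0.
  have /dimvS : (B1 + B2 <= P)%VS by rewrite subv_add BP1.
  by rewrite (min_dim mP); move: (\dim (B1 + B2)) (\dim (B1 :&: B2)); clear; lia.
set v0 := vpick (B1 :&: B2).
have /memv_capP[v0B1 v0B2] : v0 \in (B1 :&: B2)%VS by apply: memv_pick.
have be : basis_of P [tuple v1; v2; v0].
  rewrite basisEfree /= (min_dim mP) leqnn andbT; apply/andP; split.
    rewrite !free_cons nil_free !andbT; apply/and3P; split.
    - apply: contra v1B2; apply: subvP; apply/span_subvP => w.
      by rewrite !inE => /orP[] /eqP ->.
    - by apply: contra v2B1; apply: subvP; apply/span_subvP => w; rewrite inE => /eqP ->.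
    - by rewrite span_nil memv0 vpick0.
  apply/span_subvP => w; rewrite !inE => /or3P[] /eqP ->.
  - exact: (subvP BP1).
  - exact: (subvP BP2).
  - exact: (subvP BP1).
have [e' be'] := exists_basis (min_dim mP').
have [a fE] := disjoint_pair_tensor dPP be be'.
pose i0 : 'I_3 := @Ordinal 3 0 isT; pose i1 : 'I_3 := @Ordinal 3 1 isT.
pose i2 : 'I_3 := @Ordinal 3 2 isT.
have notB Q v : v \in P -> v \notin ((P + P') :&: Q)%VS -> v \notin Q.
  by move=> vP; rewrite memv_cap (subvP (addvSl P P') _ vP).
have row1 : forall j, a i1 j \in (P + P' + Q1)%VS.
  apply: (thin_row dPP be be' fE mQ1) => //; last first.
    by apply: notB; rewrite ?(subvP BP2).
  by case=> [[|[|[|i]]] hi] //= _; rewrite /tnth /=; case/memv_capP: v1B1; case/memv_capP: v0B1.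
have row2 : forall j, a i0 j \in (P + P' + Q2)%VS.
  apply: (thin_row dPP be be' fE mQ2) => //; last first.
    by apply: notB; rewrite ?(subvP BP1).
  by case=> [[|[|[|i]]] hi] //= _; rewrite /tnth /=; case/memv_capP: v2B2; case/memv_capP: v0B2.
have [|i j ij|N [cN dN]] := fill_support (A := (P + P' + Q1 + (P + P' + Q2))%VS)
    (S := setX [set i2] setT) be be' fE.
- by rewrite (subv_trans (addvSl _ Q1)) ?addvSl.
- move: ij; rewrite !inE /= andbT; case: i => [[|[|[|i]]] hi] // _.
    apply: (subvP (addvSr _ _)); rewrite (_ : Ordinal hi = i0) //; exact: val_inj.
  apply: (subvP (addvSl _ _)); rewrite (_ : Ordinal hi = i1) //; exact: val_inj.
- exists N; split=> //; rewrite (leq_trans dN) // dA cardsX cardsT cards1.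
  by rewrite card_ord.
Qed.

(** Q1 takes care of a row and Q2 of a column, which leaves four a_ij: 8 + 4 = 12. *)
Lemma thin_pair_opposite P P' Q1 Q2 : disjoint_pair P P' ->
    min_space f Q1 -> min_space f Q2 -> ~~ (Q2 <= P + P' + Q1)%VS ->
    \dim ((P + P') :&: Q1) = 2%N -> \dim ((P + P') :&: Q2) = 2%N ->
    ((P + P') :&: Q1 <= P)%VS -> ((P + P') :&: Q2 <= P')%VS ->
  covered_by f 12.
Proof.
move=> dPP mQ1 mQ2 Q2N d1 d2 BP1 BP2; have [mP mP' PP'] := dPP.
have [_ dA] := two_thirds_dim dPP mQ1 mQ2 Q2N d1 d2.
have [e [be /(_ Q1 erefl)[eQ1 e0]]] := thin_basis (addvSl P P') BP1 (min_dim mP) d1.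
have [e' [be' /(_ Q2 erefl)[eQ2 e0']]] := thin_basis (addvSr P P') BP2 (min_dim mP') d2.
have [a fE] := disjoint_pair_tensor dPP be be'.
have row := thin_row dPP be be' fE mQ1 BP1 eQ1 e0.
have fE' : val f = trilinear_sum e' e (fun j i => a i j) by rewrite fE trilinear_sum_sym.
have col i : a i ord0 \in (P + P' + Q2)%VS.
  rewrite [(P + P')%VS]addvC; apply: (thin_row (disjoint_pair_sym dPP) be' be fE' mQ2) => //.
  by rewrite addvC.
have [|i j ij|N [cN dN]] := fill_support (A := (P + P' + Q1 + (P + P' + Q2))%VS)
    (S := setX [set~ ord0] [set~ ord0]) be be' fE.
- by rewrite (subv_trans (addvSl _ Q1)) ?addvSl.
- move: ij; rewrite !inE /= negb_and !negbK => /orP[] /eqP ->.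
    exact: (subvP (addvSl _ _)).
  exact: (subvP (addvSr _ _)).
- exists N; split=> //; rewrite (leq_trans dN) // dA cardsX !cardsC1.
  by rewrite !card_ord.
Qed.

Lemma disjoint_pair_support P P' : disjoint_pair P P' ->
  covered_by f 12.
Proof.
move=> dPP; have [cD|[Q1 [mQ1 Q1D]]] := covers_or f (P + P')%VS.
  by exists (P + P')%VS; rewrite (disjoint_pair_dim dPP).
have [cD|[Q2 [mQ2 Q2D]]] := covers_or f (P + P' + Q1)%VS.
  exists (P + P' + Q1)%VS; split=> //.
  by have := third_space_dim dPP mQ1; move: (\dim _) (\dim _); clear; lia.
have thin Q : min_space f Q -> ~~ (Q <= P + P')%VS ->
    (covered_by f 12) \/ \dim ((P + P') :&: Q) = 2%N /\
    (((P + P') :&: Q <= P)%VS \/ ((P + P') :&: Q <= P')%VS).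
  move=> mQ QD.
  have : (\dim ((P + P') :&: Q) < 3)%N.
    by rewrite -(min_dim mQ) (ltn_leqif (dimv_leqif_sup (capvSr _ _))) subv_cap subvv andbT QD.
  rewrite ltnS leq_eqVlt ltnS => /orP[/eqP d2|d1]; last first.
    by left; apply: (generic_third dPP mQ); constructor 1.
  have [BP|BP] := boolP ((P + P') :&: Q <= P)%VS; first by right; split=> //; left.
  have [BP'|BP'] := boolP ((P + P') :&: Q <= P')%VS; first by right; split=> //; right.
  by left; apply: (generic_third dPP mQ); constructor 2.
have Q2D' : ~~ (Q2 <= P + P')%VS by apply: contra Q2D => /subv_trans -> //; rewrite addvSl.
have [//|[d1 s1]] := thin Q1 mQ1 Q1D; have [//|[d2 s2]] := thin Q2 mQ2 Q2D'.
have dPP' := disjoint_pair_sym dPP; have DC := addvC P P'.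
have same S S' : disjoint_pair S S' -> (S + S' = P + P')%VS ->
    ((P + P') :&: Q1 <= S)%VS -> ((P + P') :&: Q2 <= S)%VS ->
    covered_by f 12.
  move=> dSS SS B1 B2; have [eB|neB] := eqVneq ((P + P') :&: Q2)%VS ((P + P') :&: Q1)%VS.
    by apply: (thin_pair_equal (Q1 := Q1) (Q2 := Q2) dSS); rewrite ?SS.
  by apply: (thin_pair_distinct (Q1 := Q1) (Q2 := Q2) dSS); rewrite ?SS // eq_sym.
case: s1 s2 => B1 [] B2.
- exact: same dPP erefl B1 B2.
- exact: thin_pair_opposite dPP mQ1 mQ2 Q2D d1 d2 B1 B2.
- by rewrite DC in Q2D d1 d2 B1 B2; apply: thin_pair_opposite dPP' mQ1 mQ2 Q2D d1 d2 B1 B2.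
- exact: same dPP' (addvC _ _) B1 B2.
Qed.

(** * Two minimal spaces with a common vector *)

(** Here M is spanned by P, P' and the (3 - d) ^ 2 forms a_ij. *)
Lemma pair_model P P' (d : nat) : min_space f P -> min_space f P' -> \dim (P :&: P') = d ->
  exists (M : {vspace V}) (g : R), [/\ (P + P' <= M)%VS,
    (\dim M <= (6 - d) + (3 - d) * (3 - d))%N, g \is 3.-homog, supported M g
    & in_ideal_of_space (P :&: P')%VS (val f - g)].
Proof.
move=> mP mP' dW; have [_ fP] := mP; have [_ fP'] := mP'.
have [|e be] := @exists_basis _ _ (P :\: P')%VS (3 - d)%N.
  by apply/eqP; rewrite -(eqn_add2l d) -{1}dW dimv_cap_compl (min_dim mP) subnKC //
    -dW -(min_dim mP) dimvS ?capvSl.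
have [|e' be'] := @exists_basis _ _ (P' :\: P)%VS (3 - d)%N.
  by apply/eqP; rewrite -(eqn_add2l d) -{1}dW capvC dimv_cap_compl (min_dim mP') subnKC //
    -dW -(min_dim mP') dimvS ?capvSr.
have WE : (P :&: P' + <<e>>)%VS = P by rewrite (span_basis be) addvC addv_diff_cap.
have WE' : (P :&: P' + <<e'>>)%VS = P'.
  by rewrite (span_basis be') capvC addvC addv_diff_cap.
have [||||a fga] := @bilinear_decomposition _ _ (P :&: P')%VS _ _ e e' (val f).
- exact: dhomog_is_dhomog.
- by rewrite WE' (span_basis be) capv_diff.
- by rewrite WE.
- by rewrite WE'.
pose forms := [seq a s.1 s.2 | s : 'I_(3 - d) * 'I_(3 - d)].
exists (P + P' + <<forms>>)%VS, (trilinear_sum e e' a).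
have PM : (P + P' <= P + P' + <<forms>>)%VS by apply: addvSl.
split=> //; last 2 first.
- exact: trilinear_sum_homog.
- apply: trilinear_sum_supported => [i|i|i j].
  + apply/(subvP PM)/(subvP (addvSl P P'))/(subvP (diffvSl P P')).
    by apply/(basis_mem be)/mem_tnth.
  + apply/(subvP PM)/(subvP (addvSr P P'))/(subvP (diffvSl P' P)).
    by apply/(basis_mem be')/mem_tnth.
  + apply/(subvP (addvSr _ _))/memv_span; apply/mapP; exists (i, j) => //.
    by rewrite mem_enum.
rewrite (leq_trans (dim_add_span _ _)) //.
rewrite size_map -cardE card_prod !card_ord leq_add2r.
have := dimv_sum_cap P P'; rewrite dW (min_dim mP) (min_dim mP').
by move: (\dim _); clear; lia.
Qed.

(** Reduce modulo (Q) by a projection phi that fixes w and maps M into M.  From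
    f = w q + g follows w (subst phi q) = - subst phi g, which is supported on
    M; since w lies in M and is nonzero, [gam := subst phi q] is supported on M
    as well. *)
Lemma cofactor_mod_supported M g w q Q :
    supported M g -> w \in M -> val f = val w * q + g -> q \is 2.-homog ->
    in_ideal_of_space Q (val f) -> w \notin Q ->
  exists gam : R, [/\ supported M gam, gam \is 2.-homog & in_ideal_of_space Q (q - gam)].
Proof.
move=> gM wM fE hq fQ wQ.
(* C is a complement of Q :&: M in M containing w. *)
pose X := (Q :&: M + <[w]>)%VS; pose C := (<[w]> + (M :\: X))%VS.
have BwM : (X <= M)%VS by rewrite subv_add capvSr -memvE.
have CM : (C <= M)%VS by rewrite subv_add -memvE wM diffvSl.
have CQ : (C :&: Q = 0)%VS.
  apply/eqP; rewrite -subv0; apply/subvP => v /memv_capP[vC vQ].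
  have vB : v \in (Q :&: M)%VS by rewrite memv_cap vQ (subvP CM).
  have /memv_addP[_ /vlineP[c ->] [u uD vE]] := vC.
  have u0 : u = 0.
    apply/eqP; rewrite -memv0 -(capv_diff M X) memv_cap uD /=.
    by rewrite -(addKr (c *: w) u) -vE addrC memv_add // rpredN memvZ ?memv_line.
  move: vQ; rewrite vE u0 addr0; have [->|c0] := eqVneq c 0; first by rewrite scale0r !mem0v.
  by move/(memvZ c^-1); rewrite scalerK // (negPf wQ).
have MC : (M <= C + Q :&: M)%VS.
  rewrite -[X in (X <= _)%VS](addv_diff_cap M X) subv_add.
  apply/andP; split; first exact: subv_trans (addvSr _ _) (addvSl _ _).
  rewrite (capv_idPr BwM) subv_add addvSr.
  exact: subv_trans (addvSl _ _) (addvSl _ _).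
have [phi [phiQ phiC phid]] := projection_along CQ.
have phiM : (phi @: M <= M)%VS.
  rewrite (subv_trans (limgS phi MC)) // limgD subv_add; apply/andP; split.
    by apply/subvP => _ /memv_imgP[u uC ->]; rewrite phiC // (subvP CM).
  apply/subvP => _ /memv_imgP[u /memv_capP[uQ _] ->].
  by rewrite phiQ // mem0v.
have phiw : phi w = w by apply: phiC; rewrite (subvP (addvSl _ _)) ?memv_line.
exists (subst phi q); split; [|exact: subst_homog|exact: subst_diff].
have wg : val w * subst phi q = - subst phi g.
  have := subst_kill phiQ fQ; rewrite fE raddfD /= rmorphM /= subst_form phiw.
  by move/eqP; rewrite addr_eq0 => /eqP.
move=> psi psiM; have w0 : val w != 0.
  by apply: contraNneq wQ => w0; have -> : w = 0 by [apply: val_inj]; rewrite mem0v.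
apply: (mulfI w0); rewrite wg -{1}(psiM w wM) -subst_form -rmorphM /= wg raddfN /=.
by rewrite (supported_subst phiM gM).
Qed.

(** The forms b1, b2 are a basis of the plane Q :&: M and l completes it to a
    basis of Q. *)
Lemma cofactor_expansion M q gam Q : q - gam \is 2.-homog -> in_ideal_of_space Q (q - gam) ->
    \dim Q = 3%N -> \dim (Q :&: M) = 2%N ->
  exists l h0 b1 h1 b2 h2 : V, [/\ l \notin M, b1 \in M, b2 \in M, (Q <= M + <[l]>)%VS &
    q = gam + (val l * val h0 + (val b1 * val h1 + val b2 * val h2))].
Proof.
move=> hq qQ dQ dB; have [Y [Z [bYZ bZ YZ]]] := extend_basis (d := 1) (capvSl Q M) dQ dB.
have QE : (Q :&: M + <<Y>>)%VS = Q by rewrite -(span_basis bZ) addvC -span_cat (span_basis bYZ).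
have [|h [hh]] := @ideal_decomposition _ _ (Q :&: M)%VS _ Y 1 _ hq; first by rewrite QE.
rewrite big_ord1; have [h0 -> qB] := homog_form (hh ord0).
have BZ : (Q :&: M)%VS = (0 + <<Z>>)%VS by rewrite add0v (span_basis bZ).
rewrite BZ in qB; have [|h' [hh']] := ideal_decomposition (d := 1) _ qB.
  by rewrite rpredB //; apply: dhomogM (linform_homog _) (linform_homog _).
move=> /ideal_zero; rewrite !big_ord_recl big_ord0 addr0.
have [h1 ->] := homog_form (hh' ord0); have [h2 ->] := homog_form (hh' (lift ord0 ord0)).
move=> /eqP; rewrite subr_eq0 => /eqP qE.
have memB i : tnth Z i \in (Q :&: M)%VS by apply/(basis_mem bZ)/mem_tnth.
exists (tnth Y ord0), h0, (tnth Z ord0), h1, (tnth Z (lift ord0 ord0)), h2.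
have eY : tnth Y ord0 \in Y ++ Z by rewrite mem_cat mem_tnth.
split; try by case/memv_capP: (memB ord0).
- apply/negP => eM; have : tnth Y ord0 \in (<<Y>> :&: (Q :&: M))%VS.
    by rewrite !memv_cap eM memv_span ?mem_tnth ?(basis_mem bYZ).
  by rewrite YZ memv0 (negPf (basis_not0 bYZ eY)).
- by case/memv_capP: (memB (lift ord0 ord0)).
- rewrite -QE addvS ?capvSr //; apply: span_tuple_sub => i.
  by rewrite [i]ord1 memv_line.
- by rewrite -qE [_ + (_ - _)]addrC subrK addrC subrK.
Qed.

(** Suppose h0 is not in M + <l> and some minimal space Q is not contained in
    M + <l, h0>.  Then Q = (Q :&: M) + <m>, with l, m, h0 independent
    modulo M.  Take lam vanishing on M, m and h0, with lam l = 1.  Computed with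
    the expansion of q, [dderiv lam q] is h0 up to an element of M; and it lies
    in Q because lam vanishes on Q and q is supported on M modulo (Q).  So h0
    lies in M + <m>, a contradiction. *)
Lemma pencil_support P P' :
    min_space f P -> min_space f P' -> \dim (P :&: P') = 1%N ->
    (forall Q Q', min_space f Q -> min_space f Q' -> (0 < \dim (Q :&: Q'))%N) ->
  covered_by f 12.
Proof.
move=> mP mP' dW meet.
have [M [g [PM dM hg gM fg]]] := pair_model mP mP' dW.
have WM : (P :&: P' <= M)%VS by rewrite (subv_trans (capvSl _ _)) // (subv_trans (addvSl _ P')).
have through Q : min_space f Q -> (P :&: P' <= Q)%VS -> (Q <= M)%VS.
  by move=> mQ WQ; apply: min_space_supported fg gM WM WQ mQ.
have dQM Q : min_space f Q -> ~~ (P :&: P' <= Q)%VS -> (1 < \dim (Q :&: M))%N.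
  move=> mQ WQ; apply: leq_trans (meet_sum_dim dW (meet _ _ mQ mP) (meet _ _ mQ mP') WQ) _.
  exact/dimvS/capvS.
pose w := vpick (P :&: P').
have wW : w \in (P :&: P')%VS by apply: memv_pick.
have wM := subvP WM _ wW.
have W0 : (P :&: P' != 0)%VS by rewrite -dimv_eq0 dW.
have Ww : (P :&: P')%VS = <[w]>%VS.
  by apply/eqP; rewrite eq_sym eqEdim -memvE wW dW dim_vline vpick0 W0.
have [q [hq fE]] : exists q : R, q \is 2.-homog /\ val f = val w * q + g.
  have [||q [hq /ideal_zero /eqP]] := @ideal_decomposition _ _ 0%VS _ [tuple w] 2 (val f - g).
  - by rewrite rpredB // dhomog_is_dhomog.
  - by rewrite add0v span_seq1 -Ww.
  - rewrite big_ord1 (tnth_nth 0) /= subr_eq0 => /eqP fq; exists (q ord0).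
    by rewrite -fq subrK.
have residue Q : min_space f Q -> ~~ (P :&: P' <= Q)%VS ->
    exists gam : R, [/\ supported M gam, gam \is 2.-homog & in_ideal_of_space Q (q - gam)].
  move=> [_ fQ] WQ; apply: cofactor_mod_supported gM wM fE hq fQ _.
  by apply: contra WQ => wQ; rewrite Ww -memvE.
have [cM|[Q1 [mQ1 Q1M]]] := covers_or f M.
  by exists M; rewrite (leq_trans dM).
have W1 : ~~ (P :&: P' <= Q1)%VS by apply: contra Q1M; apply: through.
have [gam [gamM hgam q1]] := residue Q1 mQ1 W1.
have hom2 Q gam' : gam' \is 2.-homog -> q - gam' \is 2.-homog by move=> h; rewrite rpredB.
have d1 : \dim (Q1 :&: M) = 2%N.
  apply/eqP; rewrite eqn_leq (dQM _ mQ1 W1) andbT -ltnS -(min_dim mQ1).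
  by rewrite (ltn_leqif (dimv_leqif_sup (capvSl _ _))) subv_cap subvv.
have [l [h0 [b1 [h1 [b2 [h2 [lM b1M b2M Q1l qE]]]]]]] :=
  cofactor_expansion (hom2 Q1 gam hgam) q1 (min_dim mQ1) d1.
have dMl : (\dim (M + <[l]>) <= 10)%N.
  apply: leq_trans (dimv_add_leqif _ _) _; rewrite dim_vline.
  exact: (@leq_add _ _ 9 1 dM (leq_b1 _)).
have [h0l|h0l] := boolP (h0 \in M + <[l]>)%VS.
  exists (M + <[l]> + <<[:: h1; h2]>>)%VS.
  have MN : (M <= M + <[l]> + <<[:: h1; h2]>>)%VS := subv_trans (addvSl _ _) (addvSl _ _).
  have lN : (<[l]> <= M + <[l]> + <<[:: h1; h2]>>)%VS := subv_trans (addvSr _ _) (addvSl _ _).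
  split; last first.
    by rewrite (leq_trans (dim_add_span _ _)) //= (@leq_add _ 2 10 2).
  apply: supported_covers; rewrite fE qE; apply: supportedD; last exact: supportedS MN gM.
  apply: supportedM; first exact/supported_form/(subvP MN).
  apply: supportedD; first exact: supportedS MN gamM.
  apply: supportedD; last apply: supportedD; apply: supportedM; apply: supported_form.
  - by rewrite memvE.
  - exact: (subvP (addvSl _ _)).
  - exact: (subvP MN).
  - by apply/(subvP (addvSr _ _))/memv_span; rewrite !inE eqxx.
  - exact: (subvP MN).
  - by apply/(subvP (addvSr _ _))/memv_span; rewrite !inE eqxx orbT.
exists (M + <[l]> + <[h0]>)%VS; split; last first.
  apply: leq_trans (dimv_add_leqif _ _) _; rewrite dim_vline.
  by rewrite (leq_trans (leq_add dMl (leq_b1 _))).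
have MN : (M <= M + <[l]> + <[h0]>)%VS := subv_trans (addvSl _ _) (addvSl _ _).
move=> Q mQ; have [WQ|WQ] := boolP (P :&: P' <= Q)%VS.
  exact: subv_trans (through Q mQ WQ) MN.
apply: contraT => /subvPn[m mQ' mN].
have [gam2 [gam2M _ q2]] := residue Q mQ WQ.
have mM : m \notin M by apply: contra mN => mM; apply: (subvP MN).
have QMm : (Q <= M + <[m]>)%VS.
  have sQ : (Q :&: M + <[m]> <= Q)%VS by rewrite subv_add capvSl -memvE.
  suff : (Q <= Q :&: M + <[m]>)%VS by move/subv_trans; apply; rewrite addvS ?capvSr.
  rewrite -(geq_leqif (dimv_leqif_sup sQ)) (min_dim mQ) (leq_ltn_trans (dQM _ mQ WQ)) //.
  rewrite (ltn_leqif (dimv_leqif_sup (addvSl _ _))) subv_add negb_and -memvE.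
  by rewrite memv_cap (negPf mM) andbF orbT.
have lK : l \notin (M + <[m]> + <[h0]>)%VS.
  rewrite -addvA [(<[m]> + _)%VS]addvC addvA; apply: contra mN => lK.
  rewrite -addvA [(<[l]> + _)%VS]addvC addvA; apply: line_exchange lK _.
  by apply: contra h0l => /line_exchange; apply.
have [lam [laml lamK]] := separating_scalar lK.
have MK : (M <= M + <[m]> + <[h0]>)%VS := subv_trans (addvSl _ _) (addvSl _ _).
have lamM u : u \in M -> lam u = 0 by move=> uM; apply/lamK/(subvP MK).
have : in_ideal_of_space Q (dderiv lam (q - gam2)).
  apply: dderiv_ideal q2 => u uQ; apply: lamK; apply: (subvP (addvSl _ _)).
  exact: (subvP QMm).
have lamh0 : lam h0 = 0 by apply/lamK/(subvP (addvSr _ _))/memv_line.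
rewrite raddfB /= (dderiv_supported lamM gam2M) subr0 qE !raddfD /= !dderivM.
rewrite (dderiv_supported lamM gamM) !dderiv_form laml lamh0 (lamM _ b1M) (lamM _ b2M).
rewrite !mpolyC0 !mul0r mulr0 add0r !addr0 !add0r mul1r ![val _ * _%:MP_[_]]mulrC !mul_mpolyC.
move=> hQ; have /ideal_linform h0Q :
    in_ideal_of_space Q (val (h0 + (lam h1 *: b1 + lam h2 *: b2))) by [].
have h0M : h0 \notin M by apply: contra h0l => h0M; apply: (subvP (addvSl _ _)).
have h0Mm : h0 \in (M + <[m]>)%VS.
  rewrite -[h0](addrK (lam h1 *: b1 + lam h2 *: b2)).
  apply: memvB; first exact: (subvP QMm).
  by apply: (subvP (addvSl _ _)); rewrite memvD ?memvZ.
case/negP: mN; apply: subvP (line_exchange h0Mm h0M).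
by rewrite addvS // addvSl.
Qed.

(** By [meet_sum_dim], minimal spaces not containing P :&: P' meet P + P' in
    dimension 3, so they are contained in it. *)
Lemma deep_overlap_support P P' d : min_space f P -> min_space f P' ->
    \dim (P :&: P') = d -> (1 < d)%N ->
    (forall Q Q', min_space f Q -> min_space f Q' -> (d <= \dim (Q :&: Q'))%N) ->
  covered_by f 12.
Proof.
move=> mP mP' dW d1 meet.
have [M [g [PM dM _ gM fg]]] := pair_model mP mP' dW.
exists M; split; last first.
  apply: leq_trans dM _; have : (3 - d <= 1)%N by rewrite leq_subLR addnC -ltnS.
  by move: (3 - d)%N (leq_subr d 6) => x; nia.
move=> Q mQ; have [WQ|WQ] := boolP (P :&: P' <= Q)%VS.
  apply: min_space_supported fg gM _ WQ mQ.
  by rewrite (subv_trans (capvSl _ _)) // (subv_trans (addvSl _ P')).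
apply: subv_trans PM; have := meet_sum_dim dW (meet _ _ mQ mP) (meet _ _ mQ mP') WQ.
move=> /(leq_ltn_trans d1) h.
have : (Q <= Q :&: (P + P'))%VS.
  by rewrite -(geq_leqif (dimv_leqif_sup (capvSl _ _))) (min_dim mQ).
by rewrite subv_cap => /andP[].
Qed.

(** * The upper bound *)

Lemma least_nat (D : nat -> Prop) : (exists d, D d) ->
  exists d, D d /\ forall d', D d' -> (d <= d')%N.
Proof.
case=> d0 Dd0; apply: NNPP => noleast.
suff : forall d, ~ D d by move/(_ d0).
elim/ltn_ind => d IHd Dd; apply: noleast; exists d; split=> // d' Dd'.
by rewrite leqNgt; apply/negP => /IHd.
Qed.

Lemma Lspace_le12 : (\dim (Lspace f) <= 12)%N.
Proof.
suff [N [cN dN]] : covered_by f 12.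
  by rewrite (leq_trans (dimvS (Lspace_sub cN))).
have [P0 [dP0 fP0]] := slice_rank_space f.
have mP0 : min_space f P0.
  by split=> //; apply/eqP; rewrite eqn_leq dP0 slice_rank_le_dim.
have [|d [[P [P' [mP mP' dW]]] dmin]] := @least_nat (fun d => exists P P',
    [/\ min_space f P, min_space f P' & \dim (P :&: P') = d]).
  by exists (\dim (P0 :&: P0)), P0, P0.
have meet Q Q' : min_space f Q -> min_space f Q' -> (d <= \dim (Q :&: Q'))%N.
  by move=> mQ mQ'; apply: dmin; exists Q, Q'.
case: d dW meet {dmin} => [|[|d]] dW meet.
- apply: (disjoint_pair_support (P := P) (P' := P')); split=> //.
  by apply/eqP; rewrite -dimv_eq0 dW.
- exact: pencil_support mP mP' dW meet.
- exact: deep_overlap_support mP mP' dW _ meet.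
Qed.

End RankThree.

(** * The cubic of a complete graph *)

Section CompleteGraph.
Variables (k : fieldType) (r : nat).
Hypothesis r_gt0 : (0 < r)%N.

(** Edges are ordered pairs, so that source and target satisfy the ordering
    required by [product_relation]. *)
Definition edge := {s : 'I_r.+1 * 'I_r.+1 | (s.1 < s.2)%N}.
Local Notation n := (r + #|{: edge}|)%N.
Local Notation V := (linform k n).
Implicit Types (s t : edge) (i j : 'I_r.+1) (P : {vspace V}).

Definition source s : 'I_r.+1 := (val s).1.
Definition target s : 'I_r.+1 := (val s).2.

Definition edge_form s : V := varform k (rshift r.+1 (enum_rank s) : 'I_n.+1).
Definition vertex_forms : r.+1.-tuple V :=
  [tuple varform k (lshift #|{: edge}| i : 'I_n.+1) | i < r.+1].
Local Notation vertex_form := (tnth vertex_forms).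

Definition graph_poly : {mpoly k[n.+1]} :=
  \sum_s val (vertex_form (source s)) * val (vertex_form (target s)) * val (edge_form s).

Fact graph_poly_homog : graph_poly \is 3.-homog.
Proof.
apply: rpred_sum => s _.
exact: dhomogM (dhomogM (linform_homog _) (linform_homog _)) (linform_homog _).
Qed.
Definition graph_cubic : cubic k n := DHomog graph_poly_homog.

Lemma source_lt_target s : (source s < target s)%N.
Proof. exact: valP s. Qed.

Lemma edge_inj : injective (fun s => (source s, target s)).
Proof.
move=> s t st; apply: val_inj.
by rewrite [val s]surjective_pairing [val t]surjective_pairing; exact: st.
Qed.

Lemma vertex_forms_free : free vertex_forms.
Proof.
apply/freeP => c c0 i.
have := congr1 (fun u : V => (val u)@_U_(lshift #|{: edge}| i : 'I_n.+1)) c0.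
rewrite /= mcoeff0 !raddf_sum /= (bigD1 i) //= big1 => [|j ji].
  by rewrite nth_mktuple mcoeffZ mcoeffXU eqxx mulr1 addr0.
rewrite nth_mktuple mcoeffZ mcoeffXU; case: eqP => [/(congr1 val) /= e|_]; last by rewrite mulr0.
by case/eqP: ji; apply: val_inj.
Qed.

Lemma graph_cubic_cover P :
  (forall s, [\/ vertex_form (source s) \in P, vertex_form (target s) \in P | edge_form s \in P]) ->
  in_ideal_of_space P (val graph_cubic).
Proof.
move=> coverP; apply: ideal_sum => s _.
have [h|h|h] := coverP s; last by apply: ideal_mull; apply: ideal_mem.
  by do 2!apply: ideal_mulr; apply: ideal_mem.
by apply: ideal_mulr; apply: ideal_mull; apply: ideal_mem.
Qed.

Lemma all_forms_span (N : {vspace V}) :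
  (forall i, vertex_form i \in N) -> (forall s, edge_form s \in N) -> (fullv <= N)%VS.
Proof.
move=> vN eN; apply/subvP => u _; rewrite (linform_sum u); apply: memv_suml => i _.
apply: memvZ; case: (split_ordP (i : 'I_(r.+1 + #|{: edge}|))) => j ->.
  by have := vN j; rewrite tnth_mktuple.
by have := eN (enum_val j); rewrite /edge_form enum_valK.
Qed.

(** The edges joining the least vertex of I to the other ones are induced. *)
Lemma card_induced_edges (I : {set 'I_r.+1}) :
  (#|I| <= #|[set s | (source s \in I) && (target s \in I)]|.+1)%N.
Proof.
have [->|[i1 i1I]] := set_0Vmem I; first by rewrite cards0.
case: (arg_minnP (fun i : 'I_r.+1 => i : nat) i1I) => i0 i0I mini0.
rewrite (cardsD1 i0) [i0 \in I]i0I ltnS.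
apply: leq_trans (leq_imset_card target _).
apply/subset_leq_card/subsetP => i; rewrite !inE => /andP[ii0 iI].
have lt_i0 : ((i0, i).1 < (i0, i).2)%N by rewrite /= ltn_neqAle eq_sym ii0 mini0.
apply/imsetP; exists (Sub (i0, i) lt_i0); last by rewrite /target SubK.
by rewrite inE /source /target SubK /= iI andbT.
Qed.

(** Choose by exchange a set I of vertices such that the forms of I are a basis
    of <<vertex_forms>> modulo P.  By [product_relation] the edge forms inside
    I are combinations of the other edge forms modulo
    <<vertex_forms>> + P, so the number of these edges is at most
    [\dim (<<vertex_forms>> + P) - r.+1], that is at most
    [#|I| + \dim P - r.+1]; it is at least [#|I|.-1] as well. *)
Lemma graph_cubic_rank_ge P : in_ideal_of_space P (val graph_cubic) -> (r <= \dim P)%N.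
Proof.
move=> fP; have [I [IP Icov]] := steinitz vertex_forms P.
pose inner := [set s | (source s \in I) && (target s \in I)].
pose N := (<<vertex_forms>> + P + <<[seq edge_form s | s <- enum (~: inner)]>>)%VS.
have vN i : vertex_form i \in N.
  by rewrite /N -addvA; apply/(subvP (addvSl _ _))/memv_span/mem_tnth.
have outN s : s \notin inner -> edge_form s \in N.
  move=> sI; apply/(subvP (addvSr _ _))/memv_span/mapP; exists s => //.
  by rewrite mem_enum inE.
have eN s : edge_form s \in N.
  have [|/outN //] := boolP (s \in inner); rewrite inE => /andP[s1 s2].
  apply: (product_relation source_lt_target edge_inj vertex_forms_free
    (erefl (val graph_cubic)) fP IP) s1 s2.
  - by rewrite /N -addvA addvSl.
  - by rewrite (subv_trans (addvSr <<vertex_forms>> P)) ?addvSl.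
  - by move=> t tI; constructor 1; apply: outN; rewrite inE.
have dN := dimvS (all_forms_span vN eN); rewrite dim_linforms in dN.
have dN' := dim_add_span (<<vertex_forms>> + P) [seq edge_form s | s <- enum (~: inner)].
rewrite size_map -cardE -/N in dN'.
have dVP : (\dim (<<vertex_forms>> + P) <= #|I| + \dim P)%N.
  apply: (@leq_trans (\dim (subfamily_span vertex_forms I + P))).
    by apply: dimvS; rewrite subv_add Icov addvSr.
  by rewrite (leq_trans (dimv_add_leqif _ _)) // leq_add2r dim_subfamily_span.
(* a, b, e: edges inside I, other edges, all edges; d = #|I|, c = \dim P;
   v, w: dimensions of <<vertex_forms>> + P and of N. *)
have count a b c d v w e : (r.+1 + e <= w)%N -> (w <= v + b)%N -> (v <= d + c)%N ->
  (d <= a.+1)%N -> (a + b = e)%N -> (r <= c)%N by clear; lia.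
exact: count dN dN' dVP (card_induced_edges I) (cardsC inner).
Qed.

Lemma graph_cubic_vertex_cover c :
  in_ideal_of_space (subfamily_span vertex_forms [set~ c]) (val graph_cubic).
Proof.
apply: graph_cubic_cover => s; have [sc|sc] := eqVneq (source s) c.
  constructor 2; apply: mem_subfamily_span; rewrite !inE -sc.
  by apply/eqP => e; have := source_lt_target s; rewrite e ltnn.
by constructor 1; apply: mem_subfamily_span; rewrite !inE.
Qed.

Lemma slice_rank_graph_cubic : slice_rank graph_cubic = r.
Proof.
apply/eqP; rewrite eqn_leq; apply/andP; split.
  rewrite (leq_trans (slice_rank_le_dim (graph_cubic_vertex_cover ord0))) //.
  by rewrite (leq_trans (dim_subfamily_span _ _)) // cardsC1 card_ord.
have [P [dP fP]] := slice_rank_space graph_cubic.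
exact: leq_trans (graph_cubic_rank_ge fP) dP.
Qed.

Lemma graph_cubic_min_space P : in_ideal_of_space P (val graph_cubic) ->
  (\dim P <= r)%N -> min_space graph_cubic P.
Proof.
move=> fP dP; split=> //; apply/eqP; rewrite eqn_leq slice_rank_graph_cubic dP.
exact: graph_cubic_rank_ge.
Qed.

(** A vertex variable lies in the cover omitting another vertex.  The variable of
    an edge s, together with the vertices outside s, covers all edges. *)
Lemma Lspace_graph_cubic : Lspace graph_cubic = fullv.
Proof.
apply/eqP; rewrite eqEsubv subvf; apply: all_forms_span => [i|s].
  have [c ci] : exists c : 'I_r.+1, c != i.
    have [->|i0] := eqVneq i ord0; last by exists ord0; rewrite eq_sym.
    by exists ord_max; rewrite -val_eqE /= -lt0n.
  apply: (subvP (min_space_sub_Lspace (graph_cubic_min_space (graph_cubic_vertex_cover c) _))).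
    by rewrite (leq_trans (dim_subfamily_span _ _)) // cardsC1 card_ord.
  by apply: mem_subfamily_span; rewrite !inE eq_sym.
pose X := [set~ source s] :\ target s.
pose P := (<[edge_form s]> + subfamily_span vertex_forms X)%VS.
have st : target s != source s.
  by apply/eqP => e; have := source_lt_target s; rewrite e ltnn.
have cX : #|X|.+1 = r.
  have : #|[set~ source s]| = r by rewrite cardsC1 card_ord.
  by rewrite (cardsD1 (target s)) !inE st.
have mP : min_space graph_cubic P.
  apply: graph_cubic_min_space; last first.
    apply: leq_trans (dimv_add_leqif _ _) _; apply: (@leq_trans (1 + #|X|)).
      by apply: leq_add (dim_subfamily_span _ _); rewrite dim_vline leq_b1.
    by rewrite add1n cX.
  apply: graph_cubic_cover => t.
  have memX i : i \in X -> vertex_form i \in P.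
    by move=> iX; apply/(subvP (addvSr _ _))/mem_subfamily_span.
  have [/memX h|t1] := boolP (source t \in X); first by constructor 1.
  have [/memX h|t2] := boolP (target t \in X); first by constructor 2.
  constructor 3; have -> : t = s; last by rewrite (subvP (addvSl _ _)) ?memv_line.
  move: t1 t2; rewrite !inE !negb_and !negbK => t1 t2.
  have lts := source_lt_target s; have ltt := source_lt_target t.
  apply: edge_inj; case/orP: t1 => /eqP t1; case/orP: t2 => /eqP t2; rewrite ?t1 ?t2 //;
    by move: ltt; rewrite t1 t2 ?ltnn // ltnNge (ltnW lts).
by apply: (subvP (min_space_sub_Lspace mP)); rewrite (subvP (addvSl _ _)) ?memv_line.
Qed.

End CompleteGraph.

Lemma card_edge3 : #|{: edge 3}| = 6%N.
Proof.
rewrite card_sig -sum1_card big_mkcond (eq_bigr (fun s : 'I_4 * 'I_4 => (s.1 < s.2)%N : nat)).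
  by rewrite -(pair_bigA _ (fun i j : 'I_4 => (i < j)%N : nat)) /= !big_ord_recl !big_ord0.
by move=> s _; rewrite inE; case: (s.1 < s.2)%N.
Qed.

(** * The maximum *)

Local Close Scope ring_scope.

Theorem theorem4p5 (k : fieldType) :
  exists c : nat, is_c k 3 c /\ (10 <= c <= 12)%N.
Proof.
(* The maximum is reached by a cubic with the least defect. *)
pose defect d := exists (n : nat) (f : cubic k n),
  slice_rank f = 3 /\ \dim (Lspace f) + d = 12.
have defect2 : defect 2.
  exists (3 + #|{: edge 3}|), (graph_cubic k 3); split.
    exact: slice_rank_graph_cubic.
  by rewrite Lspace_graph_cubic // dim_linforms card_edge3.
have [|d [[n [f [rk3 dL]]] dmin]] := @least_nat defect; first by exists 2.
exists (\dim (Lspace f)); split; last first.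
  by have := dmin 2 defect2; move: (\dim _) dL; clear; lia.
split=> [|m g rkg]; first by exists n, f.
have g12 := Lspace_le12 rkg.
have := dmin (12 - \dim (Lspace g)) (ex_intro _ m (ex_intro _ g (conj rkg (subnKC g12)))).
by move: (\dim _) (\dim _) dL g12; clear; lia.
Qed.
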